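(* Let $P_0,P_1$ be real symmetric positive definite $n\times n$ matrices and let $\sigma$ be a real scalar. Consider the optimization problem $$\min_{P_t,A_t}\left\{\int_0^1\operatorname{tr}(P_t^{-1}A_tP_tA_t')\,dt\;\middle|\;\dot P_t=A_tP_t+P_tA_t'+\sigma^2 I\text{ on }[0,1],\ P_t|_{t=0}=P_0,\ P_t|_{t=1}=P_1\right\}.$$ Suppose there exists a path $(P_t,\Pi_t)$, $t\in[0,1]$, satisfying the differential equations $$\dot P_t=-2P_t\Pi_tP_t+\sigma^2 I,\qquad \dot\Pi_t=2\Pi_tP_t\Pi_t,$$ with $P_t$ equal to $P_0$ at $t=0$ and to $P_1$ at $t=1$. Then $P_t$ is an optimal solution to the problem of minimizing $\int_0^1\operatorname{tr}(P_t^{-1}A_tP_tA_t')\,dt$ over $P_t,A_t$ subject to $\dot P_t=A_tP_t+P_tA_t'+\sigma^2 I$ on $[0,1]$ with $P_t$ equal to the given $P_0$ at $t=0$ and the given $P_1$ at $t=1$, and the corresponding optimal $A_t$ is $$A_t=-P_t\Pi_t.$$ Moreover, the path $P_t$ also satisfies the differential equation $$\ddot P_t-\dot P_tP_t^{-1}\dot P_t+\sigma^4P_t^{-1}=0.$$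
   Context: $I$ is the $n\times n$ identity matrix, $'$ denotes transpose, and $\operatorname{tr}$ is the trace. All covariance paths $P_t$ (both the competitors in the minimization and the path in the hypothesis) are functions on $[0,1]$ with values in the real symmetric positive definite $n\times n$ matrices, and $A_t$ and $\Pi_t$ take values in $\mathbb{R}^{n\times n}$. *)

(* Defs.v *)
From HB Require Import structures.
From mathcomp Require Import all_boot all_order all_algebra.
From mathcomp Require Import all_classical all_reals all_analysis.

Set Implicit Arguments.
Unset Strict Implicit.
Unset Printing Implicit Defensive.

Import Order.TTheory GRing.Theory Num.Theory.
Import numFieldTopology.Exports numFieldNormedType.Exports.

Local Open Scope classical_set_scope.
Local Open Scope ring_scope.

Definition spdmx (R : realType) (n : nat) (M : 'M[R]_n) : Prop :=
  M^T = M /\ forall v : 'cV[R]_n, v != 0 -> 0 < (v^T *m M *m v) 0 0.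

(* A path on [0, 1] is a total function R -> 'M[R]_n whose values outside
   [0, 1] are irrelevant.  Hence the difference quotient only uses points s of
   [0, 1], and the derivative is one-sided at t = 0 and at t = 1. *)
Definition has_deriv01_at (R : realType) (n : nat)
    (X : R -> 'M[R]_n) (t : R) (D : 'M[R]_n) : Prop :=
  (s - t)^-1 *: (X s - X t) @[s --> within `[0, 1] t^'] --> D.

Definition has_deriv01 (R : realType) (n : nat) (X D : R -> 'M[R]_n) : Prop :=
  forall t : R, t \in `[0, 1] -> has_deriv01_at X t (D t).

Definition running_cost (R : realType) (n : nat) (P A : R -> 'M[R]_n) (t : R)
    : R :=
  \tr (invmx (P t) *m A t *m P t *m (A t)^T).

(* The running cost is nonnegative when P is positive definite, so the integral
   is meaningful, possibly +oo, as soon as the running cost is measurable. *)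
Definition cost (R : realType) (n : nat) (P A : R -> 'M[R]_n) : \bar R :=
  (\int[lebesgue_measure]_(t in `[0%R, 1%R]) (running_cost P A t)%:E)%E.

Definition admissible (R : realType) (n : nat) (sigma : R) (P0 P1 : 'M[R]_n)
    (P A : R -> 'M[R]_n) : Prop :=
  [/\ forall t : R, t \in `[0, 1] -> spdmx (P t),
      has_deriv01 P
        (fun t => A t *m P t + P t *m (A t)^T + (sigma ^+ 2)%:M),
      P 0 = P0,
      P 1 = P1
    & measurable_fun (`[0, 1]%classic : set R) (running_cost P A)].

Definition optimal (R : realType) (n : nat) (sigma : R) (P0 P1 : 'M[R]_n)
    (P A : R -> 'M[R]_n) : Prop :=
  admissible sigma P0 P1 P A /\
  forall Q B : R -> 'M[R]_n, admissible sigma P0 P1 Q B ->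
    (cost P A <= cost Q B)%E.

(* Main.v *)
Require Import Defs.
From HB Require Import structures.
From mathcomp Require Import all_boot all_order all_algebra.
From mathcomp Require Import all_classical all_reals all_analysis.
From mathcomp Require Import measurable_realfun complex ring lra.

(* The running cost minimised over the controls producing a given derivative of
   the covariance is, up to the exact derivative of [s / 2 * \tr (invmx (P t))]
   with [s = sigma ^+ 2], a quarter of the squared speed of the path in the
   affine-invariant metric on positive definite matrices plus the potential
   [s ^+ 2 / 4 * \tr (invmx P ^+ 2)].  Both are convex along geodesics, so a
   stationary path [P] is a minimiser.  Quantitatively, for a competitor [Q] the
   function [<dP, log_P Q>] has a derivative at most the difference of the two
   Lagrangians and vanishes at both ends.  Logarithms of matrices are avoided: on
   the compact range of the eigenvalues of [invmx P *m Q], [ln] is replaced by a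
   polynomial [f] with [x * f^`() x] uniformly close to [1].  In a basis that
   diagonalises [P] and [Q] simultaneously the inequality is a sum of scalar
   ones, for which it suffices that the divided difference of [f] at [u], [v]
   lies between [u^-1] and [v^-1] up to a small error. *)

Set Implicit Arguments.
Unset Strict Implicit.
Unset Printing Implicit Defensive.

Import Order.TTheory GRing.Theory Num.Theory.
Import numFieldTopology.Exports numFieldNormedType.Exports.

Local Open Scope classical_set_scope.
Local Open Scope ring_scope.

(** * Simultaneous diagonalisation *)

(** Over [R[i]] the matrix is Hermitian, so the spectral theorem diagonalises it with real
    eigenvalues; being an eigenvalue then descends to [R]. *)
Lemma symmetric_eigenvalue (R : rcfType) (n : nat) (A : 'M[R]_n.+1) :
  A^T = A -> exists a, eigenvalue A a.
Proof.
move=> Asym; pose B := map_mx (real_complex R) A.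
have Breal : B \is a mxOver Num.real.
  by apply/mxOverP => i j; rewrite mxE; apply/complex_realP; exists (A i j).
have Bsym : B \is hermitianmx _ false idfun.
  apply/is_hermitianmxP; rewrite expr0 scale1r map_mx_id //.
  by rewrite map_trmx Asym.
have Bherm := realsym_hermsym Bsym Breal.
have [/hermitian_normalmx/orthomx_spectralP Bspec Dreal] :=
  (Bherm, hermitian_spectral_diag_real Bherm).
have /complex_realP[r rE] := mxOverP Dreal 0 0.
exists r; rewrite -(eigenvalue_map (real_complex R)) -/B.
set U := spectralmx B in Bspec.
have Uu : U \in unitmx by exact: spectral_unit.
apply/eigenvalueP; exists (row 0 U).
  rewrite -row_mul {1}Bspec !mulmxA mulmxV // mul1mx row_mul row_diag_mx -scalemxAl.
  by rewrite -rowE rE.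
apply/negP => /eqP row0; have := congr1 (mulmx^~ (invmx U)) row0.
rewrite -row_mul mulmxV // mul0mx => /rowP/(_ 0); rewrite !mxE eqxx => /eqP.
by rewrite oner_eq0.
Qed.

Lemma spdmx_unit (R : realType) (n : nat) (P : 'M[R]_n) : spdmx P -> P \in unitmx.
Proof.
case=> Psym Ppos; rewrite -row_free_unit -kermx_eq0; apply/eqP/row_matrixP => i.
rewrite row0; apply/eqP; apply: contraT => v0.
have := Ppos (row i (kermx P))^T; rewrite trmx_eq0 => /(_ v0).
by rewrite trmxK -row_mul mulmx_ker row0 mul0mx mxE ltxx.
Qed.

Lemma spdmx_diag_gt0 (R : realType) (n : nat) (P : 'M[R]_n) (i : 'I_n) :
  spdmx P -> 0 < P i i.
Proof.
case=> _ /(_ (delta_mx i 0)); rewrite trmx_delta -rowE -colE !mxE; apply.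
apply/negP => /eqP/matrixP/(_ i 0); rewrite !mxE !eqxx => /eqP.
by rewrite oner_eq0.
Qed.

Lemma spdmx_congr (R : realType) (m n : nat) (P : 'M[R]_n) (G : 'M[R]_(m, n)) :
  spdmx P -> row_free G -> spdmx (G *m P *m G^T).
Proof.
case=> Psym Ppos Gfree; split; first by rewrite !trmx_mul trmxK Psym mulmxA.
move=> v v0; have /Ppos : G^T *m v != 0.
  rewrite -trmx_eq0 trmx_mul trmxK; apply: contra_neq v0 => /eqP.
  by rewrite mulmx_free_eq0 // trmx_eq0 => /eqP.
by rewrite trmx_mul trmxK !mulmxA.
Qed.

Lemma spdmx_drsub (R : realType) (m n : nat) (P : 'M[R]_(m + n)) :
  spdmx P -> spdmx (drsubmx P).
Proof.
move=> Pspd; have -> : drsubmx P =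
    row_mx 0 1%:M *m P *m (row_mx (0 : 'M[R]_(n, m)) 1%:M)^T.
  rewrite -{2}[P]submxK mul_row_block !mul0mx !mul1mx !add0r tr_row_mx.
  by rewrite mul_row_col trmx0 trmx1 mulmx0 mulmx1 add0r.
apply: spdmx_congr => //; apply/row_freeP; exists (col_mx 0 1%:M).
by rewrite mul_row_col mul0mx mul1mx add0r.
Qed.

(** Completes a nonzero row, up to a scalar, to an invertible matrix: [w] has rank 1, so its
    Gaussian factorisation retains only the first row of [row_ebase w]. *)
Lemma row_ebase_first (F : fieldType) (n : nat) (w : 'rV[F]_n.+1) : w != 0 ->
  exists c, w = c *: row 0 (row_ebase w).
Proof.
move=> w0; exists (col_ebase w 0 0).
rewrite -{1}(mulmx_ebase w) rank_rV w0 [col_ebase w]mx11_scalar.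
rewrite !mul_scalar_mx -scalemxAl mxE eqxx mulr1n; congr (_ *: _).
apply/rowP => j; rewrite !mxE (bigD1 ord0) //= big1 ?addr0 => [|i i0].
  by rewrite !mxE eqxx mul1r.
by rewrite !mxE (negbTE (_ : (ord0 : 'I_1) != i :> nat)) ?mul0r // eq_sym.
Qed.

(* A generalized eigenvector of [Q] relative to [P] is completed to an
   invertible matrix; the Schur complement that clears the first row of the
   transformed [P] then also clears the one of the transformed [Q]. *)
Lemma spdmx_deflate (R : realType) (n : nat) (P Q : 'M[R]_(1 + n))
    (w : 'rV[R]_(1 + n)) (l : R) :
  spdmx P -> Q^T = Q -> w != 0 -> w *m Q = l *: (w *m P) ->
  exists G : 'M[R]_(1 + n), exists P2 Q2 : 'M[R]_n,
    [/\ G \in unitmx, spdmx P2, Q2^T = Q2,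
        G *m P *m G^T = block_mx 1%:M 0 0 P2
      & G *m Q *m G^T = block_mx l%:M 0 0 Q2].
Proof.
move=> Pspd Qsym w0 wQ; pose H := row_ebase w.
have Hu : H \in unitmx by exact: row_ebase_unit.
have [c wE] := row_ebase_first w0.
have c0 : c != 0 by apply: contraNneq w0 => c0; rewrite wE c0 scale0r.
have uQ : usubmx H *m Q = l *: (usubmx H *m P).
  have -> : usubmx H = row 0 H.
    by apply/rowP => j; rewrite !mxE; congr (H _ _); apply/val_inj.
  move: wQ; rewrite wE -!scalemxAl scalerA [l * c]mulrC -scalerA.
  by move/(scalerI c0).
have P'spd : spdmx (H *m P *m H^T) by apply: spdmx_congr; rewrite ?row_free_unit.
set P' := H *m P *m H^T in P'spd *; set Q' := H *m Q *m H^T.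
have Q'sym : Q'^T = Q' by rewrite /Q' !trmx_mul trmxK Qsym mulmxA.
have uQ' : usubmx Q' = l *: usubmx P'.
  have uE (M : 'M[R]_(1 + n)) : usubmx (H *m M *m H^T) = usubmx H *m M *m H^T.
    by rewrite -!mul_usub_mx.
  by rewrite /Q' /P' !uE uQ -scalemxAl.
have ulQ' : ulsubmx Q' = l *: ulsubmx P'.
  by rewrite /ulsubmx uQ'; apply/matrixP => i j; rewrite !mxE.
have urQ' : ursubmx Q' = l *: ursubmx P'.
  by rewrite /ursubmx uQ'; apply/matrixP => i j; rewrite !mxE.
have dlsym (M : 'M[R]_(1 + n)) : M^T = M -> dlsubmx M = (ursubmx M)^T.
  by move=> MT; rewrite trmx_ursub MT.
pose a := ulsubmx P' 0 0; pose b := ursubmx P'.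
have ulP' : ulsubmx P' = a%:M.
  exact: mx11_scalar.
have a_gt0 : 0 < a.
  have ulE (M : 'M[R]_(1 + n)) : ulsubmx M 0 0 = M (lshift n 0) (lshift n 0).
    by rewrite !mxE.
  by rewrite /a ulE; exact: spdmx_diag_gt0.
have sa0 : Num.sqrt a != 0 by rewrite sqrtr_eq0 -ltNge.
pose r := (Num.sqrt a)^-1.
have rra : r * r * a = 1.
  by rewrite -[a in LHS]sqr_sqrtr ?ltW // /r; field.
(* Rescales the first coordinate so that [a] becomes 1, and clears the rest of the first column by
   subtracting multiples of the first row. *)
pose L : 'M[R]_(1 + n) := block_mx r%:M 0 (- a^-1 *: b^T) 1%:M.
have Lu : L \in unitmx.
  rewrite unitmxE det_lblock det1 mulr1 det_scalar1 unitfE.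
  by rewrite /r invr_eq0.
have LT : L^T = block_mx r%:M (- a^-1 *: b) 0 1%:M.
  by rewrite /L tr_block_mx trmx0 trmx1 tr_scalar_mx linearZ /= trmxK.
(* Covers both forms at once: [m = 1] for [P'] and [m = l] for [Q'], whose first row is [l] times
   that of [P']. *)
have LML (M : 'M[R]_(1 + n)) (m : R) : M^T = M -> ulsubmx M = (m * a)%:M ->
    ursubmx M = m *: b ->
    L *m M *m L^T = block_mx m%:M 0 0 (drsubmx (L *m M *m L^T)).
  move=> Msym ulM urM.
  have -> : L *m M *m L^T = block_mx m%:M 0 0
      (drsubmx M - (m / a) *: (b^T *m b)).
    rewrite -{1}[M]submxK ulM urM (dlsym _ Msym) urM LT /L !mulmx_block.
    rewrite ?(mul0mx, mulmx0, addr0, add0r, mul1mx, mulmx1) [(m *: b)^T]linearZ /=.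
    rewrite -!scalemxAr -?scalemxAl !mul_scalar_mx ?mul_mx_scalar.
    rewrite -?scalemxAl ?mul_scalar_mx !scalerA -!scalerDl -?scalemxAl !scalerA.
    have a0 := lt0r_neq0 a_gt0.
    congr block_mx.
    - apply/matrixP => i j; rewrite !mxE mulrnAr; congr (_ *+ _).
      by rewrite -[RHS]mulr1 -rra; ring.
    - by rewrite (_ : _ + _ = 0) ?scale0r //; field.
    - by rewrite (_ : _ + _ = 0) ?mulr0 ?scale0r //; field.
    - rewrite addrA -!scalerDl addrC; congr (_ + _); rewrite -scaleNr; congr (_ *: _).
      by field.
  by rewrite block_mxKdr.
have trL (M : 'M[R]_(1 + n)) : M^T = M -> (L *m M *m L^T)^T = L *m M *m L^T.
  by move=> MT; rewrite !trmx_mul trmxK MT mulmxA.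
exists (L *m H), (drsubmx (L *m P' *m L^T)), (drsubmx (L *m Q' *m L^T)).
have LHM (M : 'M[R]_(1 + n)) :
    L *m H *m M *m (L *m H)^T = L *m (H *m M *m H^T) *m L^T.
  by rewrite trmx_mul !mulmxA.
rewrite !LHM -/P' -/Q'; split.
- by rewrite unitmx_mul Lu.
- by apply: spdmx_drsub; apply: spdmx_congr; rewrite ?row_free_unit.
- by rewrite trmx_drsub trL.
- by apply: LML; rewrite ?mul1r ?scale1r //; case: P'spd.
- by apply: LML; rewrite // ulQ' ulP' -scalemx1 scalerA scalemx1.
Qed.

Lemma block_diag_congr (R : comPzRingType) (n : nat) (G : 'M[R]_n) (a : 'M[R]_1)
    (M : 'M[R]_n) :
  block_mx 1%:M 0 0 G *m block_mx a 0 0 M *m (block_mx 1%:M 0 0 G)^T =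
  block_mx a 0 0 (G *m M *m G^T) :> 'M[R]_(1 + n).
Proof.
rewrite tr_block_mx !trmx0 trmx1 !mulmx_block.
by rewrite !(mul0mx, mulmx0, addr0, add0r, mul1mx, mulmx1).
Qed.

Lemma block_diag_unit (R : comUnitRingType) (n : nat) (G : 'M[R]_n) :
  G \in unitmx -> block_mx 1%:M 0 0 G \in @unitmx R (1 + n).
Proof. by rewrite !unitmxE det_lblock det1 mul1r. Qed.

(** Deflation against the zero form: every nonzero vector is then a generalized eigenvector with
    [l = 0], so [P] is reduced one dimension at a time without computing eigenvalues. *)
Lemma spdmx_whiten (R : realType) (n : nat) (P : 'M[R]_n) : spdmx P ->
  exists2 G : 'M[R]_n, G \in unitmx & G *m P *m G^T = 1%:M.
Proof.
elim: n P => [|n IHn] P Pspd.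
  by exists 1%:M; [exact: unitmx1|apply/matrixP => -[]].
have w0 : const_mx 1 != 0 :> 'rV[R]_(1 + n).
  by apply/negP => /eqP/matrixP/(_ 0 0); rewrite !mxE => /eqP; rewrite oner_eq0.
have := @spdmx_deflate R n P 0 (const_mx 1) 0 Pspd (trmx0 _ _ _) w0.
rewrite mulmx0 scale0r => /(_ erefl)[G [P2 [_ [Gu /IHn[G2 G2u GP2] _ GP _]]]].
exists (block_mx 1%:M 0 0 G2 *m G).
  by rewrite unitmx_mul block_diag_unit.
rewrite trmx_mul -!mulmxA [G *m _]mulmxA [_ *m (G^T *m _)]mulmxA GP.
by rewrite mulmxA block_diag_congr GP2 -scalar_mx_block.
Qed.

(** By induction. Whitening [P] turns the generalized eigenvalue problem into that of the symmetric
    matrix [W *m Q *m W^T]; an eigenvector [v] of it gives [w = v *m W], along which both forms are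
    deflated. *)
Lemma spdmx_simdiag (R : realType) (n : nat) (P Q : 'M[R]_n) :
  spdmx P -> Q^T = Q ->
  exists G : 'M[R]_n, exists e : 'rV[R]_n,
    [/\ G \in unitmx, G *m P *m G^T = 1%:M & G *m Q *m G^T = diag_mx e].
Proof.
elim: n P Q => [|n IHn] P Q Pspd Qsym.
  by exists 1%:M, 0; split; [exact: unitmx1|apply/matrixP => -[]..].
have [W Wu WP] := spdmx_whiten Pspd.
have WQsym : (W *m Q *m W^T)^T = W *m Q *m W^T.
  by rewrite !trmx_mul trmxK Qsym mulmxA.
have [l /eigenvalueP[v vQ v0]] := symmetric_eigenvalue WQsym.
have w0 : v *m W != 0.
  by apply: contra_neq v0 => /eqP; rewrite mulmx_free_eq0 ?row_free_unit // => /eqP.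
have wQ : (v *m W) *m Q = l *: ((v *m W) *m P).
  have WTu : W^T \in unitmx by rewrite unitmx_tr.
  apply: (can_inj (mulmxK WTu)); move: vQ; rewrite !mulmxA => ->.
  by rewrite -scalemxAl -!mulmxA [W *m (_ *m _)]mulmxA WP mulmx1.
have [G [P2 [Q2 [Gu P2spd Q2sym GP GQ]]]] := spdmx_deflate Pspd Qsym w0 wQ.
have [G2 [e2 [G2u GP2 GQ2]]] := IHn _ _ P2spd Q2sym.
exists (block_mx 1%:M 0 0 G2 *m G), (row_mx l%:M e2).
have GM M : block_mx 1%:M 0 0 G2 *m G *m M *m (block_mx 1%:M 0 0 G2 *m G)^T =
    block_mx 1%:M 0 0 G2 *m (G *m M *m G^T) *m (block_mx 1%:M 0 0 G2)^T.
  by rewrite trmx_mul !mulmxA.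
rewrite !GM GP GQ !block_diag_congr GP2 GQ2 -scalar_mx_block; split => //.
  by rewrite unitmx_mul block_diag_unit.
rewrite {1}(_ : l%:M = diag_mx (l%:M : 'rV_1)); last first.
  by apply/matrixP => i j; rewrite !mxE !ord1.
exact: (esym (diag_mx_row (l%:M : 'rV_1) e2)).
Qed.

(** * A polynomial substitute for the logarithm *)

(* [(a ^+ k.+1 - b ^+ k.+1) / (a - b)], extended to [a = b]. *)
Definition divdiffX (R : pzRingType) (k : nat) (a b : R) : R :=
  \sum_(i < k.+1) a ^+ i * b ^+ (k - i).

Lemma divdiffXC (R : comPzRingType) (k : nat) (a b : R) :
  divdiffX k a b = divdiffX k b a.
Proof.
rewrite /divdiffX (reindex_inj rev_ord_inj); apply: eq_bigr => i _ /=.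
by rewrite subSS subKn 1?mulrC // -ltnS.
Qed.

Section log_polynomial.
Variables (R : realType) (c : R) (N : nat).

(* The Taylor polynomial of [ln] at [c], shifted so as to vanish at [1]; its
   derivative is [(1 - (1 - x / c) ^+ N) / x]. *)
Definition logpoly (x : R) : R :=
  \sum_(k < N) k.+1%:R^-1 * ((1 - c^-1) ^+ k.+1 - (1 - x / c) ^+ k.+1).

(** For [x != y] this is [(logpoly x - logpoly y) / (x - y)]; the sum also gives the derivative at
    [x = y], so coinciding eigenvalues need no separate case. *)
Definition logpoly_divdiff (x y : R) : R :=
  c^-1 * \sum_(k < N) k.+1%:R^-1 * divdiffX k (1 - x / c) (1 - y / c).

Lemma logpoly_divdiffC (x y : R) : logpoly_divdiff x y = logpoly_divdiff y x.
Proof.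
by rewrite /logpoly_divdiff; congr (_ * _); apply: eq_bigr => k _; rewrite divdiffXC.
Qed.

(** Each of the [k.+1] terms of [divdiffX k a b] lies between [a ^+ k] and [b ^+ k]. *)
Lemma divdiffX_bounds (k : nat) (a b : R) : 0 <= a -> a <= b ->
  a ^+ k <= k.+1%:R^-1 * divdiffX k a b <= b ^+ k.
Proof.
move=> a0 ab; have b0 := le_trans a0 ab.
have k0 : 0 < k.+1%:R :> R by [].
rewrite ler_pdivlMl // ler_pdivrMl // !mulr_natl.
have cs (x : R) : x *+ k.+1 = \sum_(i < k.+1) x by rewrite sumr_const card_ord.
rewrite !cs.
apply/andP; split; apply: ler_sum => i _.
  rewrite -{1}(subnKC (_ : i <= k)%N) -1?ltnS // exprD.
  by apply: ler_wpM2l; rewrite ?exprn_ge0 // lerXn2r.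
have -> : b ^+ k = b ^+ i * b ^+ (k - i) by rewrite -exprD subnKC // -ltnS.
by apply: ler_wpM2r; rewrite ?exprn_ge0 // lerXn2r.
Qed.

(** For [ln] itself the divided difference lies between [u^-1] and [v^-1], and the product is at
    most 0. Here, with [d] the divided difference, summing the bounds on [divdiffX] geometrically
    gives [u * d >= 1 - a ^+ N] and [0 <= v * d <= 1 - b ^+ N]. *)
Lemma logpoly_divdiff_key (u v : R) : 0 < c -> 0 < v -> v <= u -> u <= c ->
  (u * logpoly_divdiff u v - 1) * (v * logpoly_divdiff u v - 1) <=
  (1 - v / c) ^+ N.
Proof.
move=> c0 v0 vu uc; set a := 1 - u / c; set b := 1 - v / c.
have a0 : 0 <= a by rewrite subr_ge0 ler_pdivrMr // mul1r.
have ab : a <= b by rewrite lerD2l lerN2 ler_pM2r ?invr_gt0.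
have b0 := le_trans a0 ab.
have b1 : b <= 1 by rewrite gerBl divr_ge0 // ltW.
pose S := \sum_(k < N) k.+1%:R^-1 * divdiffX k a b.
have dE : logpoly_divdiff u v = c^-1 * S by [].
have uE : u / c = 1 - a by rewrite /a; ring.
have vE : v / c = 1 - b by rewrite /b; ring.
have geo (x : R) : (1 - x) * \sum_(k < N) x ^+ k = 1 - x ^+ N.
  by rewrite -opprB mulNr -subrX1 opprB.
have lo : 1 - a ^+ N <= u * logpoly_divdiff u v.
  rewrite dE mulrA uE -geo; apply: ler_wpM2l.
    by rewrite -uE divr_ge0 ?ltW // (lt_le_trans v0).
  by apply: ler_sum => k _; have /andP[] := divdiffX_bounds k a0 ab.
have hi : v * logpoly_divdiff u v <= 1 - b ^+ N.
  rewrite dE mulrA vE -geo; apply: ler_wpM2l; first by rewrite -vE divr_ge0 ?ltW.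
  by apply: ler_sum => k _; have /andP[] := divdiffX_bounds k a0 ab.
have lo0 : 0 <= v * logpoly_divdiff u v.
  rewrite dE mulrA; apply: mulr_ge0; first by rewrite divr_ge0 ?ltW.
  apply: sumr_ge0 => k _; have /andP[+ _] := divdiffX_bounds k a0 ab.
  by apply: le_trans; rewrite exprn_ge0.
have aNbN : a ^+ N <= b ^+ N by rewrite lerXn2r.
have bN0 : 0 <= b ^+ N by rewrite exprn_ge0.
set x := u * _ in lo *; set y := v * _ in hi lo0 *.
(* If [x >= 1] the product is nonpositive; otherwise [1 - x <= a ^+ N <= b ^+ N] and
   [0 <= 1 - y <= 1]. *)
have [x1|x1] := lerP 1 x; first by nra.
by nra.
Qed.

(** Completing the square in [q] leaves [p ^+ 2] times [r ^+ N - (u * d - 1) * (v * d - 1)],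
    nonnegative by [logpoly_divdiff_key]. *)
Lemma logpoly_kinetic (u v p q r : R) : 0 < c -> 0 < u <= c -> 0 < v <= c ->
  1 - u / c <= r -> 1 - v / c <= r ->
  0 <= q ^+ 2 / (u * v) - p ^+ 2 - 2 * logpoly_divdiff u v * (p * q)
       + logpoly_divdiff u v * (u + v) * p ^+ 2 + r ^+ N * p ^+ 2.
Proof.
move=> c0 /andP[u0 uc] /andP[v0 vc] ur vr; set d := logpoly_divdiff u v.
have key : (u * d - 1) * (v * d - 1) <= r ^+ N.
  have pw (x : R) : 0 < x <= c -> 1 - x / c <= r -> (1 - x / c) ^+ N <= r ^+ N.
    move=> /andP[x0 xc] xr; have x1 : 0 <= 1 - x / c by rewrite subr_ge0 ler_pdivrMr // mul1r.
    by rewrite lerXn2r // nnegrE (le_trans x1 xr).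
  have [vu|/ltW uv] := lerP v u.
    by apply: le_trans (logpoly_divdiff_key c0 v0 vu uc) (pw v _ vr); rewrite v0.
  rewrite mulrC /d logpoly_divdiffC.
  by apply: le_trans (logpoly_divdiff_key c0 u0 uv vc) (pw u _ ur); rewrite u0.
have -> : q ^+ 2 / (u * v) - p ^+ 2 - 2 * d * (p * q) + d * (u + v) * p ^+ 2
    + r ^+ N * p ^+ 2 =
    (q - u * v * d * p) ^+ 2 / (u * v)
    + (r ^+ N - (u * d - 1) * (v * d - 1)) * p ^+ 2.
  by field; rewrite !lt0r_neq0.
apply: addr_ge0; last by rewrite mulr_ge0 ?sqr_ge0 // subr_ge0.
by rewrite divr_ge0 ?sqr_ge0 // mulr_ge0 ?ltW.
Qed.

Lemma is_derive_logpoly (x : R) : x != 0 -> c != 0 ->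
  is_derive x 1 logpoly ((1 - (1 - x / c) ^+ N) / x).
Proof.
move=> x0 c0.
have d1 : is_derive x 1 (fun y : R => 1 - y / c) (- c^-1).
  have -> : (fun y : R => 1 - y / c) = cst 1 - c^-1 *: id.
    by apply/funext => y; rewrite !fctE /= [c^-1 *: y]mulrC.
  by apply: is_derive_eq; rewrite sub0r scaler1.
have dk (k : 'I_N) : is_derive x 1
    (fun y : R => k.+1%:R^-1 * ((1 - c^-1) ^+ k.+1 - (1 - y / c) ^+ k.+1))
    (c^-1 * (1 - x / c) ^+ k).
  have -> : (fun y : R => k.+1%:R^-1 * ((1 - c^-1) ^+ k.+1 - (1 - y / c) ^+ k.+1)) =
      k.+1%:R^-1 *: (cst ((1 - c^-1) ^+ k.+1) - (fun y : R => 1 - y / c) ^+ k.+1).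
    by apply/funext => y; rewrite !fctE.
  apply: is_derive_eq; rewrite sub0r /= -scalerN !scalerA /GRing.scale /=.
  have k0 : k.+1%:R != 0 :> R by [].
  by rewrite opprK mulrA mulVf // mul1r mulrC.
have := is_derive_sum dk.
have -> : \sum_(i < N) (fun y : R =>
    i.+1%:R^-1 * ((1 - c^-1) ^+ i.+1 - (1 - y / c) ^+ i.+1)) = logpoly.
  by apply/funext => y; rewrite fct_sumE.
move=> dL; apply: is_derive_eq; rewrite -mulr_sumr.
have geo : (x / c) * \sum_(k < N) (1 - x / c) ^+ k = 1 - (1 - x / c) ^+ N.
  set y := 1 - x / c; rewrite (_ : x / c = 1 - y); last by rewrite /y; ring.
  by rewrite -opprB mulNr -subrX1 opprB.
by rewrite -geo [x / c]mulrC -!mulrA [x * _]mulrC mulfVK.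
Qed.

Lemma logpoly1 : logpoly 1 = 0.
Proof. by rewrite /logpoly big1 // => k _; rewrite mul1r subrr mulr0. Qed.

Lemma ln_le_subr1 (x : R) : 0 < x -> ln x <= x - 1.
Proof.
by move=> x0; rewrite lerBrDr addrC -[leRHS](lnK x0); exact: expR_ge1Dx.
Qed.

(** [logpoly - ln] vanishes at 1 and has derivative [- (1 - y / c) ^+ N / y]. This is nonpositive on
    []0, c]], which settles [x <= 1]; between 1 and [x] it is at least [- r ^+ N], over a length of
    at most [c]. *)
Lemma logpoly_ge (x r : R) : 1 <= c -> 0 < x <= c -> 1 - 1 / c <= r ->
  ln x - c * r ^+ N <= logpoly x.
Proof.
move=> c1 /andP[x0 xc] r1; have c0 := lt_le_trans ltr01 c1.
have r0 : 0 <= r by apply: le_trans r1; rewrite subr_ge0 ler_pdivrMr // !mul1r.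
pose F y := logpoly y - ln y.
have dF (y : R) : 0 < y -> is_derive y 1 F (- (1 - y / c) ^+ N / y).
  move=> y0; have dl := is_derive_logpoly (lt0r_neq0 y0) (lt0r_neq0 c0).
  have dn := is_derive1_ln y0.
  have -> : F = logpoly - (@ln R) by [].
  apply: is_derive_eq.
  by field; rewrite lt0r_neq0.
have F1 : F 1 = 0 by rewrite /F logpoly1 ln1 subrr.
have cF (y : R) : 0 < y -> {for y, continuous F}.
  by move=> y0; apply: differentiable_continuous; apply/derivable1_diffP; have [] := dF y y0.
suff : - (c * r ^+ N) <= F x by rewrite /F; lra.
have cr : 0 <= c * r ^+ N by rewrite mulr_ge0 ?exprn_ge0 // ltW.
have wF (a b : R) : 0 < a -> {within `[a, b], continuous F}.
  move=> a0; apply: continuous_in_subspaceT => y; rewrite inE /= in_itv /= => /andP[ay _].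
  by apply: cF; exact: lt_le_trans ay.
have pos (y : R) : 0 < y -> y <= c -> 0 <= (1 - y / c) ^+ N.
  by move=> y0 yc; rewrite exprn_ge0 // subr_ge0 ler_pdivrMr // mul1r.
have [x1|x1] := lerP x 1.
  have [|y yx Fy] := @MVT_segment R F (fun y => - (1 - y / c) ^+ N / y) x 1 x1 _ (wF _ _ x0).
    by move=> y; rewrite in_itv /= => /andP[xy _]; apply: dF; exact: lt_trans xy.
  move: yx; rewrite in_itv /= => /andP[xy y1].
  have y0 := lt_le_trans x0 xy.
  have : (1 - y / c) ^+ N / y * (1 - x) >= 0.
    by rewrite mulr_ge0 ?subr_ge0 // divr_ge0 ?pos ?(ltW y0) // (le_trans y1).
  by move: Fy; rewrite F1 !mulNr; lra.
have [|y yx Fy] := @MVT_segment R F (fun y => - (1 - y / c) ^+ N / y) 1 x (ltW x1) _ (wF _ _ ltr01).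
  by move=> y; rewrite in_itv /= => /andP[xy _]; apply: dF; exact: lt_trans xy.
move: yx; rewrite in_itv /= => /andP[y1 yx].
have y0 := lt_le_trans ltr01 y1.
have : (1 - y / c) ^+ N / y * (x - 1) <= c * r ^+ N.
  have yc := le_trans yx xc.
  have ley : (1 - y / c) ^+ N / y <= r ^+ N.
    rewrite ler_pdivrMr //; apply: (@le_trans _ _ (r ^+ N)); last first.
      by rewrite ler_peMr // exprn_ge0.
    rewrite lerXn2r // ?nnegrE // ?subr_ge0 ?ler_pdivrMr ?mul1r //.
    by apply: le_trans r1; rewrite lerD2l lerN2 ler_pM2r ?invr_gt0.
  rewrite [c * _]mulrC; apply: ler_pM => //; last by lra.
  - by rewrite divr_ge0 ?(ltW y0) // pos.
  - by rewrite subr_ge0 ltW.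
by move: Fy; rewrite F1 !mulNr; lra.
Qed.

(** Apply [ln z <= z - 1] at [z = (u * v)^-1], then replace each logarithm by [logpoly] at a cost of
    [c * r ^+ N]. *)
Lemma logpoly_potential (u v r : R) : 1 <= c -> 0 < u <= c -> 0 < v <= c ->
  1 - 1 / c <= r ->
  0 <= (u * v)^-1 - 1 + logpoly u + logpoly v + 2 * c * r ^+ N.
Proof.
move=> c1 uc vc r1.
have := logpoly_ge c1 uc r1; have := logpoly_ge c1 vc r1.
move: uc vc => /andP[u0 _] /andP[v0 _].
have : 0 < (u * v)^-1 by rewrite invr_gt0 mulr_gt0.
move/ln_le_subr1; rewrite lnV ?posrE ?mulr_gt0 // lnM ?posrE //.
by lra.
Qed.

End log_polynomial.

(** * The polynomial on matrices and its derivative *)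

Section mxlogpoly.
Variables (R : realType) (n : nat) (c : R) (N : nat).
Implicit Types Y H K : 'M[R]_n.

Definition mxlogpoly Y : 'M[R]_n :=
  \sum_(k < N) k.+1%:R^-1 *:
    ((1 - c^-1) ^+ k.+1 *: 1%:M - (1%:M - c^-1 *: Y) ^+ k.+1).

(** The Frechet derivative of [mxlogpoly] at [Y] in the direction [H]; as [Y] and [H] need not
    commute, each power contributes a full Leibniz sum. *)
Definition mxlogpoly_deriv Y H : 'M[R]_n :=
  c^-1 *: \sum_(k < N) k.+1%:R^-1 *:
    \sum_(i < k.+1) (1%:M - c^-1 *: Y) ^+ i *m H *m (1%:M - c^-1 *: Y) ^+ (k - i).

Lemma expmxS Y (k : nat) : Y ^+ k.+1 = Y *m Y ^+ k.
Proof. exact: exprS. Qed.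

Lemma expmx_conj K Y (k : nat) : K \in unitmx ->
  (K *m Y *m invmx K) ^+ k = K *m Y ^+ k *m invmx K.
Proof.
move=> Ku; elim: k => [|k IHk].
  by rewrite !expr0 mulmx1 mulmxV.
by rewrite !expmxS IHk !mulmxA mulmxKV.
Qed.

Lemma expmx_diag (e : 'rV[R]_n) (k : nat) :
  (diag_mx e) ^+ k = diag_mx (\row_j e 0 j ^+ k).
Proof.
elim: k => [|k IHk].
  by apply/matrixP => i j; rewrite !mxE.
by rewrite expmxS IHk mulmx_diag; congr diag_mx; apply/rowP => j; rewrite !mxE exprS.
Qed.

Lemma conj_shift K Y : K \in unitmx ->
  1%:M - c^-1 *: (K *m Y *m invmx K) = K *m (1%:M - c^-1 *: Y) *m invmx K.
Proof.
move=> Ku; rewrite mulmxBr mulmxBl mulmx1 mulmxV //.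
by rewrite -scalemxAr -scalemxAl.
Qed.

Lemma diag_shift (e : 'rV[R]_n) :
  1%:M - c^-1 *: diag_mx e = diag_mx (\row_j (1 - e 0 j / c)).
Proof.
apply/matrixP => i j; rewrite !mxE; case: eqP => _; rewrite ?mulr1n ?mulr0n.
  by rewrite mulrC.
by rewrite mulr0 subr0.
Qed.

Lemma mxlogpoly_conj K Y : K \in unitmx ->
  mxlogpoly (K *m Y *m invmx K) = K *m mxlogpoly Y *m invmx K.
Proof.
move=> Ku; rewrite /mxlogpoly mulmx_sumr mulmx_suml; apply: eq_bigr => k _.
rewrite -scalemxAr -scalemxAl conj_shift // expmx_conj //; congr (_ *: _).
rewrite mulmxBr mulmxBl; congr (_ - _).
by rewrite -scalemxAr mulmx1 -scalemxAl mulmxV.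
Qed.

Lemma mxlogpoly_diag (e : 'rV[R]_n) :
  mxlogpoly (diag_mx e) = diag_mx (\row_j logpoly c N (e 0 j)).
Proof.
apply/matrixP => i j; rewrite /mxlogpoly diag_shift summxE !mxE /logpoly -sumrMnl.
apply: eq_bigr => k _; rewrite expmx_diag !mxE.
by case: eqP => [->|]; rewrite ?mulr1n ?mulr1 ?mulr0n ?mulr0 ?subr0 ?mulr0.
Qed.

Lemma mxlogpoly_deriv_conj K Y H : K \in unitmx ->
  mxlogpoly_deriv (K *m Y *m invmx K) (K *m H *m invmx K) =
  K *m mxlogpoly_deriv Y H *m invmx K.
Proof.
move=> Ku; rewrite /mxlogpoly_deriv -scalemxAr -scalemxAl; congr (_ *: _).
rewrite mulmx_sumr mulmx_suml; apply: eq_bigr => k _.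
rewrite -scalemxAr -scalemxAl; congr (_ *: _).
rewrite mulmx_sumr mulmx_suml; apply: eq_bigr => i _.
by rewrite conj_shift // !expmx_conj // !mulmxA !mulmxKV.
Qed.

(** An instance of the Daletskii-Krein formula; it reduces the matrix inequality to scalar ones. *)
Lemma mxlogpoly_deriv_diag (e : 'rV[R]_n) H (i j : 'I_n) :
  mxlogpoly_deriv (diag_mx e) H i j = logpoly_divdiff c N (e 0 i) (e 0 j) * H i j.
Proof.
rewrite /mxlogpoly_deriv diag_shift !mxE /logpoly_divdiff -mulrA; congr (_ * _).
rewrite summxE mulr_suml; apply: eq_bigr => k _.
rewrite mxE -mulrA; congr (_ * _); rewrite summxE /divdiffX mulr_suml.
apply: eq_bigr => l _; rewrite !expmx_diag mul_mx_diag mul_diag_mx !mxE.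
by rewrite mulrAC.
Qed.

Lemma mxlogpoly1 : mxlogpoly 1%:M = 0.
Proof.
rewrite /mxlogpoly big1 // => k _.
have -> : 1%:M - c^-1 *: 1%:M = (1 - c^-1) *: 1%:M :> 'M[R]_n.
  by rewrite scalerBl scale1r.
have -> (x : R) m : (x *: 1%:M : 'M[R]_n) ^+ m = x ^+ m *: 1%:M.
  elim: m => [|m IHm]; first by rewrite !expr0 scale1r.
  by rewrite expmxS IHm -scalemxAl mul1mx scalerA exprS.
by rewrite subrr scaler0.
Qed.

End mxlogpoly.

(** * The pointwise trace inequality *)

Lemma mxtrace_mul_sum (R : pzSemiRingType) (n : nat) (A B : 'M[R]_n) :
  \tr (A *m B) = \sum_i \sum_j A i j * B j i.
Proof. by rewrite /mxtrace; apply: eq_bigr => i _; rewrite mxE. Qed.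

Lemma mxtrace_conj (R : comUnitRingType) (n : nat) (K A : 'M[R]_n) :
  K \in unitmx -> \tr (K *m A *m invmx K) = \tr A.
Proof. by move=> Ku; rewrite -mulmxA mxtrace_mulC -mulmxA mulVmx // mulmx1. Qed.

(** Adds the sum to itself with the indices exchanged; the summands to come are controlled only in
    pairs. *)
Lemma sumr_ge0_sym (R : realDomainType) (n : nat) (x : 'I_n -> 'I_n -> R) :
  (forall i j, 0 <= x i j + x j i) -> 0 <= \sum_i \sum_j x i j.
Proof.
move=> x0; rewrite -(pmulrn_lge0 _ (isT : (0 < 2)%N)) mulr2n.
rewrite {2}exchange_big /= -big_split; apply: sumr_ge0 => i _.
by rewrite -big_split; apply: sumr_ge0 => j _; exact: x0.
Qed.

(** In a basis where [P] is the identity and [Q] is diagonal with entries [e], all traces become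
    double sums. The summands at [i], [j] and at [j], [i] together are [logpoly_kinetic] plus a
    square times [logpoly_potential]. The two trace bounds place [e] between [d^-1] and [c], whence
    the rate [r]. *)
Lemma trace_action_ge (R : realType) (n : nat) (P Q p q : 'M[R]_n) (s c d : R)
    (N : nat) (r := 1 - (c * d)^-1) (Z := invmx P *m p) (Y := invmx P *m Q) :
  spdmx P -> spdmx Q -> p^T = p -> q^T = q -> 1 <= c -> 1 <= d ->
  \tr (invmx P *m Q) <= c -> \tr (invmx Q *m P) <= d ->
  \tr (Z *m mxlogpoly_deriv c N Y (invmx P *m q - Z *m Y))
    - s ^+ 2 * \tr (invmx P *m invmx P *m mxlogpoly c N Y)
  <= 2^-1 * \tr (invmx Q *m q *m (invmx Q *m q))
     + 2^-1 * s ^+ 2 * \tr (invmx Q *m invmx Q)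
     - 2^-1 * \tr (Z *m Z) - 2^-1 * s ^+ 2 * \tr (invmx P *m invmx P)
     + r ^+ N * (2^-1 * \tr (Z *m Z) + c * s ^+ 2 * \tr (invmx P *m invmx P)).
Proof.
move=> Pspd Qspd psym qsym c1 d1 trc trd.
have [G [e [Gu GP GQ]]] := spdmx_simdiag Pspd (proj1 Qspd).
pose K := G^T; have Ku : K \in unitmx by rewrite unitmx_tr.
have [Pu Qu] := (spdmx_unit Pspd, spdmx_unit Qspd).
have e_gt0 i : 0 < e 0 i.
  have : spdmx (diag_mx e) by rewrite -GQ; apply: spdmx_congr; rewrite ?row_free_unit.
  by move=> /(spdmx_diag_gt0 i); rewrite mxE eqxx mulr1n.
pose D' := diag_mx (\row_j (e 0 j)^-1).
(* Conjugation by [K] turns these into [invmx P *m p], [invmx P *m q] and [invmx P]. *)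
pose pt := G *m p *m K; pose qt := G *m q *m K; pose T := G *m K.
have KGP : K *m (G *m P) = 1%:M by apply: mulmx1C; exact: GP.
have invP : invmx P = K *m G.
  by apply: (can_inj (mulmxK Pu)); rewrite mulVmx // -mulmxA KGP.
have KDGQ : K *m D' *m (G *m Q) = 1%:M.
  apply: mulmx1C; rewrite mulmxA GQ mulmx_diag; apply/matrixP => i j.
  by rewrite !mxE mulfV ?lt0r_neq0.
have invQ : invmx Q = K *m D' *m G.
  by apply: (can_inj (mulmxK Qu)); rewrite mulVmx // -[RHS]mulmxA KDGQ.
have ZE : Z = K *m pt *m invmx K by rewrite /Z invP /pt !mulmxA mulmxK.
have PqE : invmx P *m q = K *m qt *m invmx K by rewrite invP /qt !mulmxA mulmxK.
have PE : invmx P = K *m T *m invmx K by rewrite invP /T !mulmxA mulmxK.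
have YE : Y = K *m diag_mx e *m invmx K by rewrite /Y invP -GQ !mulmxA mulmxK.
have QqE : invmx Q *m q = K *m (D' *m qt) *m invmx K.
  by rewrite invQ /qt !mulmxA mulmxK.
have QE : invmx Q = K *m (D' *m T) *m invmx K by rewrite invQ /T !mulmxA mulmxK.
have QPE : invmx Q *m P = K *m D' *m invmx K.
  rewrite invQ -[_ *m G *m P]mulmxA; congr (_ *m _).
  by apply: (can_inj (mulKmx Ku)); rewrite KGP mulmxV.
have conjM A B : (K *m A *m invmx K) *m (K *m B *m invmx K) = K *m (A *m B) *m invmx K.
  by rewrite !mulmxA mulmxKV.
have conjB A B : K *m A *m invmx K - K *m B *m invmx K = K *m (A - B) *m invmx K.
  by rewrite mulmxBr mulmxBl.
(* A trace with positive eigenvalues dominates each of them. *)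
have e_lec i : e 0 i <= c.
  apply: le_trans trc; rewrite -/Y YE mxtrace_conj // mxtrace_diag (bigD1 i) //=.
  by rewrite lerDl; apply: sumr_ge0 => j _; exact: ltW.
have e_ged i : (e 0 i)^-1 <= d.
  apply: le_trans trd; rewrite QPE mxtrace_conj // mxtrace_diag (bigD1 i) //= mxE.
  by rewrite lerDl; apply: sumr_ge0 => j _; rewrite mxE invr_ge0 ltW.
have c0 : 0 < c by exact: lt_le_trans c1.
have d0 : 0 < d by exact: lt_le_trans d1.
have e_r i : 1 - e 0 i / c <= r.
  rewrite /r lerD2l lerN2 invfM [c^-1 * _]mulrC ler_pM2r ?invr_gt0 //.
  by rewrite -[leRHS]invrK lef_pV2 ?posrE ?invr_gt0.
have r1 : 1 - 1 / c <= r.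
  rewrite /r lerD2l lerN2 invfM [c^-1 * _]mulrC ler_pM2r ?invr_gt0 //.
  by rewrite invf_le1.
rewrite -/Z PqE !ZE YE conjM conjB mxlogpoly_deriv_conj // conjM mxlogpoly_conj //.
rewrite QqE QE PE !conjM !mxtrace_conj // mxlogpoly_diag -subr_ge0.
have symt (A : 'M[R]_n) : A^T = A -> forall i j, (G *m A *m K) j i = (G *m A *m K) i j.
  move=> At i j; have AT : (G *m A *m K)^T = G *m A *m K.
    by rewrite !trmx_mul trmxK At mulmxA.
  by rewrite -{1}AT mxE.
have ptC i j : pt j i = pt i j by exact: symt.
have qtC i j : qt j i = qt i j by exact: symt.
have TC i j : T j i = T i j by have := symt _ (trmx1 _ _) i j; rewrite mulmx1.
clearbody pt qt T.
pose S (f : 'I_n -> 'I_n -> R) := \sum_i \sum_j f i j.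
have SD f g : S f + S g = S (fun i j => f i j + g i j).
  by rewrite /S -big_split; apply: eq_bigr => i _; rewrite -big_split.
have SZ a f : a * S f = S (fun i j => a * f i j).
  by rewrite /S mulr_sumr; apply: eq_bigr => i _; rewrite mulr_sumr.
have SN f : - S f = S (fun i j => - f i j).
  by rewrite -mulN1r SZ; apply: eq_bigr => i _; apply: eq_bigr => j _; rewrite mulN1r.
have t1 : \tr (pt *m mxlogpoly_deriv c N (diag_mx e) (qt - pt *m diag_mx e)) =
    S (fun i j => pt i j * (logpoly_divdiff c N (e 0 i) (e 0 j) *
                            (qt i j - pt i j * e 0 i))).
  rewrite mxtrace_mul_sum; apply: eq_bigr => i _; apply: eq_bigr => j _.
  rewrite mxlogpoly_deriv_diag logpoly_divdiffC mul_mx_diag !mxE.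
  by rewrite (ptC i j) (qtC i j).
have t2 : \tr (T *m T *m diag_mx (\row_j logpoly c N (e 0 j))) =
    S (fun i j => T i j ^+ 2 * logpoly c N (e 0 i)).
  rewrite mxtrace_mulC mulmxA mxtrace_mul_sum; apply: eq_bigr => i _.
  by apply: eq_bigr => j _; rewrite mul_diag_mx !mxE TC; ring.
have t3 : \tr (D' *m qt *m (D' *m qt)) =
    S (fun i j => qt i j ^+ 2 / (e 0 i * e 0 j)).
  rewrite mxtrace_mul_sum; apply: eq_bigr => i _; apply: eq_bigr => j _.
  by rewrite /D' mul_diag_mx !mxE (qtC i j) invfM; ring.
have t4 : \tr (D' *m T *m (D' *m T)) = S (fun i j => T i j ^+ 2 / (e 0 i * e 0 j)).
  rewrite mxtrace_mul_sum; apply: eq_bigr => i _; apply: eq_bigr => j _.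
  by rewrite /D' mul_diag_mx !mxE (TC i j) invfM; ring.
have t5 : \tr (pt *m pt) = S (fun i j => pt i j ^+ 2).
  rewrite mxtrace_mul_sum; apply: eq_bigr => i _; apply: eq_bigr => j _.
  by rewrite (ptC i j).
have t6 : \tr (T *m T) = S (fun i j => T i j ^+ 2).
  rewrite mxtrace_mul_sum; apply: eq_bigr => i _; apply: eq_bigr => j _.
  by rewrite (TC i j).
rewrite t1 t2 t3 t4 t5 t6 !(SZ, SN, SD, SZ, SN, SD).
apply: sumr_ge0_sym => i j.
rewrite (ptC i j) (qtC i j) (TC i j) [logpoly_divdiff c N (e 0 j) _]logpoly_divdiffC.
have ei : 0 < e 0 i <= c by rewrite e_gt0 e_lec.
have ej : 0 < e 0 j <= c by rewrite e_gt0 e_lec.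
have := logpoly_kinetic N (pt i j) (qt i j) c0 ei ej (e_r i) (e_r j).
have := mulr_ge0 (sqr_ge0 (s * T i j)) (logpoly_potential N c1 ei ej r1).
move=> h1 h2; apply: le_trans (addr_ge0 h1 h2) _; rewrite le_eqVlt; apply/orP; left.
have [ei0 ej0] : e 0 i != 0 /\ e 0 j != 0 by rewrite !lt0r_neq0.
by apply/eqP; field; rewrite ei0 ej0.
Qed.

(** * Integrals of everywhere defined derivatives *)

(** Continuous induction: the supremum [s] of the times at which the bound holds satisfies it too,
    by continuity of [g] and monotonicity of [Phi]; if [s < 1], the step leads beyond it. [Phi] may
    jump. *)
Lemma increment_le_of_local (R : realType) (g Phi : R -> R) :
  (forall t : R, 0 <= t <= 1 -> forall e : R, 0 < e -> exists2 d : R, 0 < d &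
     forall s : R, 0 <= s <= 1 -> `|s - t| < d -> `|g s - g t| < e) ->
  (forall x y : R, 0 <= x -> x <= y -> y <= 1 -> Phi x <= Phi y) ->
  (forall t : R, 0 <= t < 1 ->
     exists2 s, t < s <= 1 & g s - g t <= Phi s - Phi t) ->
  g 1 - g 0 <= Phi 1 - Phi 0.
Proof.
move=> gcont Phi_nd step.
pose E := [set t : R | 0 <= t <= 1 /\ g t - g 0 <= Phi t - Phi 0].
have E0 : E 0 by split; rewrite ?lexx ?ler01 // !subrr.
have Eub : has_ubound E by exists 1 => t [/andP[]].
have Esup : has_sup E by split => //; exists 0.
set s := sup E.
have s0 : 0 <= s by exact: ub_le_sup.
have s1 : s <= 1 by apply: ge_sup; [exists 0|move=> t [/andP[]]].
have s01 : 0 <= s <= 1 by rewrite s0.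
have Es : E s.
  split=> //; rewrite leNgt; apply/negP => lt.
  have e0 : 0 < g s - g 0 - (Phi s - Phi 0) by rewrite subr_gt0.
  have [d d0 gd] := gcont s s01 _ e0.
  have [t [t01 Et] ts] := sup_adherent d0 Esup; rewrite -/s in ts.
  have tles : t <= s by apply: ub_le_sup.
  have /(gd t t01) : `|t - s| < d by rewrite ltr_norml; apply/andP; split; lra.
  rewrite ltr_norml => /andP[h _].
  by have := Phi_nd t s (proj1 (andP t01)) tles s1; lra.
case: (ltP s 1) => [lts1|ge1]; last first.
  have sE : s = 1 by apply/eqP; rewrite eq_le s1.
  by rewrite -sE; case: Es.
have [|u /andP[su u1] gu] := step s; first by rewrite s0.
have : E u by split; [rewrite u1 (le_trans s0 (ltW su))|case: Es => _; lra].
by move=> /(ub_le_sup Eub); rewrite leNgt su.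
Qed.

Lemma integral_cst01 (R : realType) (a : R) :
  (\int[lebesgue_measure]_(t in `[0%R, 1%R]) a%:E = a%:E)%E.
Proof.
transitivity (a%:E * lebesgue_measure (`[0%R, 1%R]%classic : set R))%E.
  exact: integral_cst.
by rewrite lebesgue_measure_itv /= lte_fin ltr01 oppr0 adde0 mule1.
Qed.

(** * A monotone function that grows faster than a given integrand *)

Section increasing_majorant.
Variables (R : realType) (h : R -> R) (eps : R).
Local Notation mu := (@lebesgue_measure R).
Hypotheses (mh : measurable_fun (`[0, 1]%classic : set R) h)
  (h_ge0 : forall t : R, 0 <= t <= 1 -> 0 <= h t) (eps_gt0 : 0 < eps).

Let level (k : nat) : set R :=
  `[0, 1]%classic `&` h @^-1` `[k%:R * eps, k.+1%:R * eps[%classic.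

(** On [level k] this lies between [h + eps] and [h + 2 * eps]: the lower bound gives the growth of
    [Phi], the upper one controls the weighted sum. *)
Let weight (k : nat) : R := k.+2%:R * eps.

Let weight_gt0 k : 0 < weight k.
Proof. by rewrite mulr_gt0. Qed.

Let level_measurable k : measurable (level k).
Proof. exact: mh. Qed.

Let level_sub k : level k `<=` `[0, 1].
Proof. by move=> t []. Qed.

Let level_trivIset : trivIset setT level.
Proof.
apply/trivIsetP => i j _ _ ij; apply/seteqP; split => // t [[_ /= hi] [_ /= hj]].
move: hi hj ij; rewrite !in_itv /= => /andP[hi1 hi2] /andP[hj1 hj2].
have := le_lt_trans hi1 hj2; have := le_lt_trans hj1 hi2.
rewrite !ltr_pM2r // !ltr_nat !ltnS => ji ij.
by rewrite eqn_leq ij ji.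
Qed.

Let level_cover : \bigcup_k level k = `[0, 1]%classic.
Proof.
apply/seteqP; split => [t [k _ []] //|t t01].
have ht0 : 0 <= h t / eps.
  by rewrite divr_ge0 ?(ltW eps_gt0) // h_ge0 //; move: t01; rewrite /= in_itv.
exists (Num.truncn (h t / eps)) => //; split=> //=; rewrite in_itv /=.
by have := truncn_itv ht0; rewrite ler_pdivlMr // ltr_pdivrMr.
Qed.

Let level_fin k : (mu (level k) < +oo)%E.
Proof.
apply: (@le_lt_trans _ _ (mu `[0, 1]%classic)).
  by apply: le_measure; [rewrite inE; exact: level_measurable|rewrite inE|exact: level_sub].
by rewrite lebesgue_measure_itv /= lte_fin ltr01 oppr0 adde0 ltry.
Qed.

Let weight_sum :
  (\sum_(0 <= k <oo) ((weight k)%:E * mu (level k)) <=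
   \int[mu]_(t in `[0%R, 1%R]) (h t)%:E + (2 * eps)%:E)%E.
Proof.
have mh2 : measurable_fun (`[0, 1]%classic : set R) (fun t : R => h t + 2 * eps).
  exact: measurable_funD.
have -> : (\int[mu]_(t in `[0%R, 1%R]) (h t)%:E + (2 * eps)%:E =
    \int[mu]_(t in `[0%R, 1%R]) (h t + 2 * eps)%:E)%E.
  under [RHS]eq_integral do rewrite EFinD.
  rewrite ge0_integralD //.
  - by rewrite integral_cst01.
  - exact/measurable_EFinP.
  - by move=> t _; rewrite lee_fin mulr_ge0 // ltW.
rewrite -level_cover ge0_integral_bigcup //; last 2 first.
  by rewrite level_cover; exact/measurable_EFinP.
  move=> t; rewrite level_cover /= in_itv /= => t01.
  by rewrite lee_fin addr_ge0 ?h_ge0 // mulr_ge0 // ltW.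
apply: lee_nneseries => [k _ _|k _].
  by rewrite mule_ge0 // lee_fin ltW.
have <- : (\int[mu]_(x in level k) (weight k)%:E = (weight k)%:E * mu (level k))%E.
  by apply: integral_cst; exact: level_measurable.
apply: ge0_le_integral.
- exact: level_measurable.
- by move=> t _; rewrite lee_fin ltW.
- exact: measurable_cst.
- apply/measurable_EFinP; apply: measurable_funS mh2; first exact: measurable_itv.
  exact: level_sub.
- move=> t [_ /=]; rewrite in_itv /= => /andP[+ _]; rewrite lee_fin /weight.
  by rewrite -addn2 natrD mulrDl lerD2r.
Qed.

(* As in the Vitali-Caratheodory theorem: each level set of [h] is covered by a
   slightly larger open set, and [Phi] integrates the weighted sum of the
   indicators of these open sets. *)
Lemma increasing_majorant :
  (\int[mu]_(t in `[0%R, 1%R]) (h t)%:E < +oo)%E ->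
  exists Phi : R -> R,
    [/\ forall x y : R, 0 <= x -> x <= y -> y <= 1 -> Phi x <= Phi y,
        ((Phi 1 - Phi 0)%:E <=
           \int[mu]_(t in `[0%R, 1%R]) (h t)%:E + (3 * eps)%:E)%E
      & forall t : R, 0 <= t < 1 -> exists2 d : R, 0 < d &
          forall s : R, t < s -> s < t + d -> s <= 1 ->
            (h t + eps) * (s - t) <= Phi s - Phi t].
Proof.
move=> ih_fin.
(* The excess measure allowed for [U k]: multiplied by [weight k] and summed over [k] it amounts to
   [eps]. *)
have delta_gt0 k : 0 < eps / (2 ^ k.+1)%:R / weight k.
  by rewrite !divr_gt0 // ltr0n expn_gt0.
have [U UP] := choice (fun k => lebesgue_regularity_outer
  (level_measurable k) (level_fin k) (delta_gt0 k)).
have Uo k : open (U k) by have [] := UP k.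
have levU k : level k `<=` U k by have [] := UP k.
have mU k : measurable (U k) by exact: open_measurable.
(* The integral over []x, y]] of the weighted indicators; half-open intervals make it additive. *)
pose F (x y : R) : \bar R :=
  (\sum_(0 <= k <oo) ((weight k)%:E * mu (U k `&` `]x, y]%classic)))%E.
have w0 k : (0 <= (weight k)%:E)%E by rewrite lee_fin ltW.
have mUI k (x y : R) : measurable (U k `&` `]x, y]%classic) by exact: measurableI.
have F0 x y : (0 <= F x y)%E.
  by apply: nneseries_ge0 => k _ _; rewrite mule_ge0.
have Fadd x y z : x <= y -> y <= z -> (F x z = F x y + F y z)%E.
  move=> xy yz; rewrite /F -nneseriesD; try by move=> k _ _; rewrite mule_ge0.
  apply: eq_eseriesr => k _; rewrite -ge0_muleDr // -measureU //.
    congr (_ * mu _)%E; rewrite -setIUr; congr (_ `&` _).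
    by rewrite -itv_bndbnd_setU // bnd_simp.
  - exact: mUI.
  - exact: mUI.
  apply/seteqP; split => // u [[_ /=] + [_ /=]]; rewrite !in_itv /=.
  by move=> /andP[_ uy] /andP[yu _]; move: (lt_le_trans yu uy); rewrite ltxx.
have mu_le k : (mu (U k `&` `]0%R, 1%R]%classic) <=
    mu (level k) + (eps / (2 ^ k.+1)%:R / weight k)%:E)%E.
  have [_ _ /ltW Ud] := UP k.
  apply: (@le_trans _ _ (mu (U k))).
    by apply: le_measure; [rewrite inE; exact: mUI|rewrite inE; exact: mU|exact: subIsetl].
  rewrite -(setDUK (levU k)) measureU //.
  - by rewrite leeD2l // setDUK.
  - exact: level_measurable.
  - by apply: measurableD; [exact: mU|exact: level_measurable].
  - by rewrite setDE setICA setICr setI0.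
have Fle : (F 0%R 1%R <= \int[mu]_(t in `[0%R, 1%R]) (h t)%:E + (3 * eps)%:E)%E.
  apply: (@le_trans _ _ (\sum_(0 <= k <oo) ((weight k)%:E * mu (level k) +
                                            (eps / (2 ^ k.+1)%:R)%:E))%E).
    apply: lee_nneseries => [k _ _|k _]; first by rewrite mule_ge0.
    apply: (le_trans (lee_wpmul2l (w0 k) (mu_le k))).
    rewrite ge0_muleDr // ?lee_fin ?(ltW (delta_gt0 k)) //.
    by rewrite leeD2l // -EFinM lee_fin mulrC divfK // lt0r_neq0.
  apply: (le_trans (epsilon_trick _ _ (ltW eps_gt0))).
    by move=> k; rewrite mule_ge0.
  apply: (le_trans (leeD2r _ weight_sum)).
  by rewrite -addeA -EFinD leeD2l // lee_fin; lra.
have Ffin x y : 0 <= x -> x <= y -> y <= 1 -> (F x y \is a fin_num).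
  move=> x0 xy y1; rewrite ge0_fin_numE //; apply: (@le_lt_trans _ _ (F 0 1)).
    rewrite (Fadd 0 x 1) ?(le_trans xy) // (Fadd x y 1) //.
    by rewrite addeCA leeDl // adde_ge0.
  by apply: le_lt_trans Fle _; rewrite lte_add_pinfty // ltry.
have FB x y : 0 <= x -> x <= y -> y <= 1 ->
    fine (F 0 y) - fine (F 0 x) = fine (F x y).
  move=> x0 xy y1; rewrite (Fadd 0 x y) // fineD ?Ffin //; last exact: le_trans y1.
  by rewrite addrAC subrr add0r.
exists (fun t => fine (F 0 t)); split.
- by move=> x y x0 xy y1; rewrite -subr_ge0 FB // fine_ge0.
- by rewrite FB // fineK // Ffin.
- move=> t /andP[t0 t1].
  have [k _ [t01 /=]] : (\bigcup_k level k) t.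
    by rewrite level_cover /= in_itv /= t0 ltW.
  rewrite in_itv /= => /andP[hk hk1].
  have /nbhs_ballP[d /= d0 Ud] : nbhs t (U k).
    by apply: open_nbhs_nbhs; split => //; apply: levU; split => //=; rewrite in_itv /= hk.
  exists d => // s ts std s1; rewrite FB // ?(ltW ts) //.
  have tsU : `]t, s]%classic `<=` U k.
    move=> u /=; rewrite in_itv /= => /andP[tu us]; apply: Ud.
    by rewrite /ball /= ltr_norml; apply/andP; split; lra.
  rewrite -lee_fin fineK ?Ffin // ?(ltW ts) //.
  (* Only the term of the level containing [t] is kept: []t, s]] lies inside its open set, and
     [weight k] exceeds [h t + eps]. *)
  rewrite /F (@nneseriesD1 _ _ k) //; last by move=> i _; rewrite mule_ge0.
  apply: (@le_trans _ _ ((weight k)%:E * mu (U k `&` `]t, s]%classic))%E).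
    have -> : U k `&` `]t, s] = `]t, s]%classic.
      by apply/seteqP; split=> [u []//|u us]; split => //; exact: tsU.
    rewrite lebesgue_measure_itv /= lte_fin ts -EFinB -EFinM lee_fin.
    rewrite ler_pM2r ?subr_gt0 // /weight.
    by rewrite -addn1 natrD mulrDl mul1r lerD2r ltW.
  by rewrite leeDl // nneseries_ge0 // => i _ _; rewrite mule_ge0.
Qed.

End increasing_majorant.

(* The derivative [d] exists everywhere but may be neither bounded nor
   integrable, so that no version of the fundamental theorem of calculus for
   continuous derivatives applies. *)
Lemma le_integral_deriv01 (R : realType) (g d h : R -> R) :
  (forall t : R, t \in `[0, 1] ->
     (s - t)^-1 * (g s - g t) @[s --> within `[0, 1] t^'] --> d t) ->
  (forall t : R, t \in `[0, 1] -> d t <= h t) ->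
  (forall t : R, t \in `[0, 1] -> 0 <= h t) ->
  measurable_fun (`[0, 1]%classic : set R) h ->
  ((g 1 - g 0)%:E <= \int[lebesgue_measure]_(t in `[0%R, 1%R]) (h t)%:E)%E.
Proof.
move=> dg dh h0 mh.
have h0' (t : R) : 0 <= t <= 1 -> 0 <= h t by move=> t01; apply: h0; rewrite in_itv.
have local (t e : R) : 0 <= t <= 1 -> 0 < e -> exists2 r : R, 0 < r &
    forall s : R, 0 <= s <= 1 -> s != t -> `|s - t| < r ->
      `|(s - t)^-1 * (g s - g t) - d t| < e.
  move=> t01 e0; have t01' : t \in `[0, 1] by rewrite in_itv.
  have /cvgrPdist_lt /(_ e e0) := dg t t01'.
  move=> /nbhs_ballP[r /= r0 H]; exists r => // s s01 st sr.
  rewrite distrC; apply: (H s) => //=; first by rewrite /ball /= distrC.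
have [|ih] := ltP (\int[lebesgue_measure]_(t in `[0%R, 1%R]) (h t)%:E)%E +oo%E; last first.
  by move: ih; rewrite leye_eq => /eqP ->; rewrite leey.
move=> ih; apply/lee_addgt0Pr => e e0.
(* [increasing_majorant] may exceed the integral by three times its [eps]. *)
have e30 : 0 < e / 3 by rewrite divr_gt0.
have [Phi [Phi_nd Phi_le Phi_step]] := increasing_majorant mh h0' e30 ih.
rewrite (_ : e = 3 * (e / 3)); last by field.
apply: le_trans Phi_le; rewrite lee_fin.
apply: increment_le_of_local => // t t01.
  move=> e1 e10; have [r r0 H] := local t 1 t01 ltr01.
  (* Near [t] the difference quotient is within 1 of [d t], hence bounded by [m], which gives
     continuity at [t]. *)
  pose m := 1 + `|d t|; have m0 : 0 < m by rewrite ltr_pwDl.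
  exists (Num.min r (e1 / m)); first by rewrite lt_min r0 divr_gt0.
  move=> s s01; rewrite lt_min => /andP[sr sm].
  have [->|st] := eqVneq s t; first by rewrite subrr normr0.
  have st0 : s - t != 0 by rewrite subr_eq0.
  have := H s s01 st sr; set q := _^-1 * _ => Hq.
  have gE : g s - g t = (s - t) * q by rewrite /q mulrA mulfV // mul1r.
  have qm : `|q| <= m.
    have := ler_normD (q - d t) (d t); rewrite subrK => /le_trans; apply.
    by rewrite lerD2r ltW.
  rewrite gE normrM; apply: (@le_lt_trans _ _ (`|s - t| * m)); first by rewrite ler_wpM2l.
  by rewrite -ltr_pdivlMr.
have [/andP[t0 t1]] := t01.
have t01c : 0 <= t <= 1 by rewrite t0 ltW.
have [r r0 H] := local t (e / 3) t01c e30.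
have [r' r'0 H'] := Phi_step t t01.
(* A point to the right of [t], near enough for the quotient to stay below [d t + e / 3], hence
   below [h t + e / 3], and for the growth of [Phi] to apply. *)
pose s := t + Num.min (Num.min r r') (1 - t) / 2.
have m0 : 0 < Num.min (Num.min r r') (1 - t) by rewrite !lt_min r0 r'0 subr_gt0.
have mr : Num.min (Num.min r r') (1 - t) <= r by rewrite !ge_min lexx.
have mr' : Num.min (Num.min r r') (1 - t) <= r' by rewrite !ge_min lexx !orbT.
have m1 : Num.min (Num.min r r') (1 - t) <= 1 - t by rewrite !ge_min lexx !orbT.
have ts : t < s by rewrite /s; lra.
have s1 : s <= 1 by rewrite /s; lra.
exists s; first by rewrite ts.
apply: le_trans (H' s ts _ s1); last by rewrite /s; lra.
have s01 : 0 <= s <= 1 by rewrite s1 (le_trans t0 (ltW ts)).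
have st : s != t by rewrite gt_eqF.
have Hq : `|(s - t)^-1 * (g s - g t) - d t| < e / 3.
  by apply: H => //; rewrite gtr0_norm ?subr_gt0 // /s; lra.
rewrite -ler_pdivrMr ?subr_gt0 // mulrC.
have t01' : t \in `[0, 1] by rewrite in_itv.
by move: Hq (dh t t01'); rewrite ltr_norml => /andP[_]; lra.
Qed.

(** * Calculus of paths on the unit interval *)

Section cvg_matrix.
Variables (R : realType) (T : Type) (F : set_system T) (FF : Filter F).

Lemma cvg_mxP (m n : nat) (f : T -> 'M[R]_(m, n)) (A : 'M[R]_(m, n)) :
  f x @[x --> F] --> A <-> forall i j, f x i j @[x --> F] --> A i j.
Proof.
split=> [fA i j|fA].
  apply/cvgrPdist_le => e e0; move/cvgrPdist_le : fA => /(_ e e0).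
  apply: filterS => x; apply: le_trans.
  rewrite [leRHS]/Num.Def.normr /= mx_normrE.
  have := @le_bigmax _ _ _ 0 (fun ij : 'I_m * 'I_n => `|(A - f x) ij.1 ij.2|) (i, j).
  by rewrite !mxE.
apply/cvgrPdist_le => e e0; near=> x.
rewrite [leLHS]/Num.Def.normr /= mx_normrE (bigmax_le _ (ltW e0)) //= => ij _.
rewrite !mxE; move: ij; near: x; apply: filter_forall => /= ij.
exact: ((cvgrPdist_le _ _).1 (fA ij.1 ij.2)).
Unshelve. all: by end_near. Qed.

Lemma cvg_sumr (I : Type) (r : seq I) (f : I -> T -> R) (a : I -> R) :
  (forall i, f i x @[x --> F] --> a i) ->
  \sum_(i <- r) f i x @[x --> F] --> \sum_(i <- r) a i.
Proof.
move=> fa; elim: r => [|i r IHr].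
  by rewrite big_nil; under eq_cvg do rewrite big_nil; exact: cvg_cst.
by rewrite big_cons; under eq_cvg do rewrite big_cons; exact: cvgD.
Qed.

Lemma cvg_prodr (I : Type) (r : seq I) (f : I -> T -> R) (a : I -> R) :
  (forall i, f i x @[x --> F] --> a i) ->
  \prod_(i <- r) f i x @[x --> F] --> \prod_(i <- r) a i.
Proof.
move=> fa; elim: r => [|i r IHr].
  by rewrite big_nil; under eq_cvg do rewrite big_nil; exact: cvg_cst.
by rewrite big_cons; under eq_cvg do rewrite big_cons; exact: cvgM.
Qed.

Lemma cvg_mulmx (m n p : nat) (f : T -> 'M[R]_(m, n)) (g : T -> 'M[R]_(n, p))
    (A : 'M[R]_(m, n)) (B : 'M[R]_(n, p)) :
  f x @[x --> F] --> A -> g x @[x --> F] --> B ->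
  f x *m g x @[x --> F] --> A *m B.
Proof.
move=> /cvg_mxP fA /cvg_mxP gB; apply/cvg_mxP => i j.
rewrite mxE; under eq_cvg do rewrite mxE.
by apply: cvg_sumr => k; exact: cvgM.
Qed.

Lemma cvg_trmx (m n : nat) (f : T -> 'M[R]_(m, n)) (A : 'M[R]_(m, n)) :
  f x @[x --> F] --> A -> (f x)^T @[x --> F] --> A^T.
Proof.
move=> /cvg_mxP fA; apply/cvg_mxP => i j.
by rewrite mxE; under eq_cvg do rewrite mxE; exact: fA.
Qed.

Lemma cvg_mxtrace (n : nat) (f : T -> 'M[R]_n) (A : 'M[R]_n) :
  f x @[x --> F] --> A -> \tr (f x) @[x --> F] --> \tr A.
Proof. by move=> /cvg_mxP fA; apply: cvg_sumr => i; exact: fA. Qed.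

Lemma cvg_det (n : nat) (f : T -> 'M[R]_n) (A : 'M[R]_n) :
  f x @[x --> F] --> A -> \det (f x) @[x --> F] --> \det A.
Proof.
move=> /cvg_mxP fA; apply: cvg_sumr => s.
by apply: cvgM; [exact: cvg_cst|apply: cvg_prodr => i; exact: fA].
Qed.

Lemma cvg_adjugate (n : nat) (f : T -> 'M[R]_n) (A : 'M[R]_n) :
  f x @[x --> F] --> A -> \adj (f x) @[x --> F] --> \adj A.
Proof.
move=> /cvg_mxP fA; apply/cvg_mxP => i j.
rewrite mxE; under eq_cvg do rewrite mxE.
apply: cvgM; first exact: cvg_cst.
apply: cvg_det; apply/cvg_mxP => k l.
by rewrite !mxE; under eq_cvg do rewrite !mxE; exact: fA.
Qed.

(** By the adjugate formula. As [invmx] returns a singular matrix unchanged, invertibility is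
    assumed along the filter. *)
Lemma cvg_invmx (n : nat) (f : T -> 'M[R]_n) (A : 'M[R]_n) : A \in unitmx ->
  f x @[x --> F] --> A -> (\forall x \near F, f x \in unitmx) ->
  invmx (f x) @[x --> F] --> invmx A.
Proof.
move=> Au fA fu.
have -> : invmx A = (\det A)^-1 *: \adj A by rewrite /invmx Au.
apply: (@cvg_trans _ ((\det (f x))^-1 *: \adj (f x) @[x --> F])).
  apply: near_eq_cvg; near=> x; rewrite /invmx ifT //; near: x; exact: fu.
apply: cvgZ; last exact: cvg_adjugate.
by apply: cvgV; [rewrite -unitfE -unitmxE|exact: cvg_det].
Unshelve. all: by end_near. Qed.

End cvg_matrix.

(** * Differentiation rules relative to [[0, 1]] *)

Section has_deriv01.
Variables (R : realType).
Local Notation nbhs01 t := (within `[0, 1] t^').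

Lemma cvg_punctured01 (t : R) : s - t @[s --> nbhs01 t] --> (0 : R).
Proof.
apply: cvg_within_filter.
have h : s - t @[s --> t^'] --> t - t by apply: cvgB; [exact: cvg_within|exact: cvg_cst].
by rewrite subrr in h.
Qed.

(** The tool for most rules below: difference quotients may be rewritten algebraically away from
    [s = t]. *)
Lemma eq_cvg_punctured01 (V : topologicalType) (f g : R -> V) (t : R) (l : V) :
  (forall s, s - t != 0 -> s \in `[0, 1] -> f s = g s) ->
  f s @[s --> nbhs01 t] --> l -> g s @[s --> nbhs01 t] --> l.
Proof.
move=> fg; apply: cvg_trans; apply: near_eq_cvg.
rewrite near_withinE near_withinE; near=> s => st s01; apply: fg => //.
by rewrite subr_eq0.
Unshelve. all: by end_near. Qed.

(** Makes derivatives unique, endpoints included: from either half of the interval one can move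
    towards the other by up to 1/2. *)
Lemma punctured01_proper (t : R) : t \in `[0, 1] -> ProperFilter (nbhs01 t).
Proof.
rewrite in_itv /= => /andP[t0 t1]; apply: Build_ProperFilter_ex => A.
move=> /nbhs_ballP[e /= e0 H].
pose m := Num.min (e / 2) (1 / 2).
have m0 : 0 < m by rewrite lt_min !divr_gt0.
have me : m <= e / 2 by rewrite ge_min lexx.
have m1 : m <= 1 / 2 by rewrite ge_min lexx orbT.
have [th|th] := lerP t (1 / 2).
  exists (t + m); apply: H => /=.
  - by rewrite /ball /= opprD addrA subrr sub0r normrN gtr0_norm //; lra.
  - by rewrite -subr_eq0 addrAC subrr add0r gt_eqF.
  - by rewrite in_itv /=; apply/andP; split; lra.
exists (t - m); apply: H => /=.
- by rewrite /ball /= opprB addrCA subrr addr0 gtr0_norm //; lra.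
- by rewrite -subr_eq0 addrAC subrr add0r oppr_eq0 gt_eqF.
- by rewrite in_itv /=; apply/andP; split; lra.
Qed.

Variable n : nat.
Implicit Types X Y D E : 'M[R]_n.

Lemma has_deriv01_cvg (X : R -> 'M[R]_n) (t : R) D :
  has_deriv01_at X t D -> X s @[s --> nbhs01 t] --> X t.
Proof.
move=> dX; rewrite -[X in _ --> X]add0r -[X in X + _](scale0r D).
apply: eq_cvg_punctured01 (cvgD (cvgZ (cvg_punctured01 t) dX) (cvg_cst (X t))) => s st _.
by rewrite scalerA mulfV // scale1r subrK.
Qed.

Lemma has_deriv01_unique (X : R -> 'M[R]_n) (t : R) D E : t \in `[0, 1] ->
  has_deriv01_at X t D -> has_deriv01_at X t E -> D = E.
Proof.
move=> t01 dD dE; have FP := punctured01_proper t01.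
apply/matrixP => i j; move/cvg_mxP : dD => /(_ i j) dD; move/cvg_mxP : dE => /(_ i j).
exact: cvg_unique.
Qed.

Lemma has_deriv01_cst (A : 'M[R]_n) (t : R) : has_deriv01_at (fun=> A) t 0.
Proof.
by rewrite /has_deriv01_at; under eq_cvg do rewrite subrr scaler0; exact: cvg_cst.
Qed.

Lemma has_deriv01D (X Y : R -> 'M[R]_n) (t : R) D E :
  has_deriv01_at X t D -> has_deriv01_at Y t E ->
  has_deriv01_at (fun s => X s + Y s) t (D + E).
Proof.
move=> dX dY; apply: eq_cvg_punctured01 (cvgD dX dY) => s _ _.
by rewrite -scalerDr opprD addrACA.
Qed.

Lemma has_deriv01Z (X : R -> 'M[R]_n) (t : R) D (a : R) :
  has_deriv01_at X t D -> has_deriv01_at (fun s => a *: X s) t (a *: D).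
Proof.
move=> dX; apply: eq_cvg_punctured01 (cvgZ (cvg_cst a) dX) => s _ _.
by rewrite -scalerBr !scalerA mulrC.
Qed.

Lemma has_deriv01N (X : R -> 'M[R]_n) (t : R) D :
  has_deriv01_at X t D -> has_deriv01_at (fun s => - X s) t (- D).
Proof.
move=> dX; apply: eq_cvg_punctured01 (cvgN dX) => s _ _.
by rewrite -scalerN opprD.
Qed.

Lemma has_deriv01B (X Y : R -> 'M[R]_n) (t : R) D E :
  has_deriv01_at X t D -> has_deriv01_at Y t E ->
  has_deriv01_at (fun s => X s - Y s) t (D - E).
Proof. by move=> dX /has_deriv01N; exact: has_deriv01D. Qed.

Lemma has_deriv01_sum (I : Type) (r : seq I) (X : I -> R -> 'M[R]_n) (t : R)
    (D : I -> 'M[R]_n) :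
  (forall i, has_deriv01_at (X i) t (D i)) ->
  has_deriv01_at (fun s => \sum_(i <- r) X i s) t (\sum_(i <- r) D i).
Proof.
move=> dX; elim: r => [|i r IHr].
  rewrite big_nil (_ : (fun _ => _) = fun=> 0); first exact: has_deriv01_cst.
  by apply/funext => s; rewrite big_nil.
rewrite big_cons (_ : (fun _ => _) = fun s => X i s + \sum_(j <- r) X j s).
  exact: has_deriv01D.
by apply/funext => s; rewrite big_cons.
Qed.

Lemma has_deriv01M (X Y : R -> 'M[R]_n) (t : R) D E :
  has_deriv01_at X t D -> has_deriv01_at Y t E ->
  has_deriv01_at (fun s => X s *m Y s) t (D *m Y t + X t *m E).
Proof.
move=> dX dY; apply: eq_cvg_punctured01 (cvgD (cvg_mulmx _ dX (has_deriv01_cvg dY))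
  (cvg_mulmx _ (cvg_cst (X t)) dY)) => s _ _.
by rewrite -scalemxAl -scalemxAr -scalerDr mulmxBl mulmxBr addrA subrK.
Qed.

Lemma has_deriv01T (X : R -> 'M[R]_n) (t : R) D :
  has_deriv01_at X t D -> has_deriv01_at (fun s => (X s)^T) t D^T.
Proof.
move=> dX; apply: eq_cvg_punctured01 (cvg_trmx _ dX) => s _ _.
by rewrite linearZ linearB.
Qed.

Lemma has_deriv01V (X : R -> 'M[R]_n) (t : R) D :
  t \in `[0, 1] -> (forall s, s \in `[0, 1] -> X s \in unitmx) ->
  has_deriv01_at X t D ->
  has_deriv01_at (fun s => invmx (X s)) t (- (invmx (X t) *m D *m invmx (X t))).
Proof.
move=> t01 Xu dX; have Xtu := Xu t t01.
have iX : invmx (X s) @[s --> nbhs01 t] --> invmx (X t).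
  apply: cvg_invmx => //; first exact: has_deriv01_cvg dX.
  by rewrite near_withinE; near=> s => s01; exact: Xu.
(* Rests on [invmx (X s) - invmx (X t) = - (invmx (X s) *m (X s - X t) *m invmx (X t))]. *)
apply: eq_cvg_punctured01
  (cvgN (cvg_mulmx _ (cvg_mulmx _ iX dX) (cvg_cst (invmx (X t))))) => s _ s01.
have Xsu : X s \in unitmx by exact: Xu.
rewrite -scalemxAr -scalemxAl -scalerN mulmxBr mulVmx // mulmxBl mul1mx.
by rewrite -mulmxA mulmxV // mulmx1 opprB.
Unshelve. all: by end_near. Qed.

Lemma has_deriv01X (X : R -> 'M[R]_n) (t : R) D (k : nat) :
  has_deriv01_at X t D ->
  has_deriv01_at (fun s => X s ^+ k.+1) t
    (\sum_(i < k.+1) X t ^+ i *m D *m X t ^+ (k - i)).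
Proof.
move=> dX; elim: k => [|k IHk].
  by rewrite big_ord1 subnn !expr0 mulmx1 mul1mx.
have -> : \sum_(i < k.+2) X t ^+ i *m D *m X t ^+ (k.+1 - i) = D *m X t ^+ k.+1
    + X t *m \sum_(i < k.+1) X t ^+ i *m D *m X t ^+ (k - i).
  rewrite big_ord_recl subn0 expr0 mul1mx mulmx_sumr; congr (_ + _).
  by apply: eq_bigr => i _; rewrite subSS !mulmxA -expmxS.
exact: has_deriv01M dX IHk.
Qed.

Lemma has_deriv01_mxlogpoly (c : R) (N : nat) (Y : R -> 'M[R]_n) (t : R) E :
  has_deriv01_at Y t E ->
  has_deriv01_at (fun s => mxlogpoly c N (Y s)) t (mxlogpoly_deriv c N (Y t) E).
Proof.
move=> dY; rewrite /mxlogpoly_deriv scaler_sumr; apply: has_deriv01_sum => k.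
rewrite scalerA mulrC -scalerA; apply: has_deriv01Z.
have dW := has_deriv01B (has_deriv01_cst 1%:M t) (@has_deriv01Z Y t E c^-1 dY).
have := has_deriv01B (has_deriv01_cst ((1 - c^-1) ^+ k.+1 *: 1%:M) t) (@has_deriv01X _ _ _ k dW).
rewrite !sub0r -sumrN scaler_sumr.
under eq_bigr do rewrite mulmxN mulNmx opprK -scalemxAr -scalemxAl.
by [].
Qed.

Lemma has_deriv01_trace (X : R -> 'M[R]_n) (t : R) D :
  has_deriv01_at X t D ->
  (s - t)^-1 * (\tr (X s) - \tr (X t)) @[s --> nbhs01 t] --> \tr D.
Proof.
move=> dX; apply: eq_cvg_punctured01 (cvg_mxtrace _ dX) => s _ _.
by rewrite mxtraceZ linearB.
Qed.

Lemma continuous_trace01 (X D : R -> 'M[R]_n) : has_deriv01 X D ->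
  {within `[0, 1], continuous (fun s => \tr (X s))}.
Proof.
move=> dX; apply/subspace_continuousP => t t01 A At.
have h : \tr (X s) @[s --> nbhs01 t] --> \tr (X t).
  by apply: cvg_mxtrace; exact: has_deriv01_cvg (dX t t01).
have /nbhs_ballP[e e0 H] :
  nbhs t (fun s => s != t -> s \in `[0, 1] -> A (\tr (X s))) := h A At.
apply/nbhs_ballP; exists e => // s bs s01.
have [->|st] := eqVneq s t; first exact: (nbhs_singleton At).
exact: H.
Qed.

End has_deriv01.

(** * Optimality *)

Lemma cvg_quotient_affine (R : realType) (f : R -> R) (t d M : R) :
  (u - t)^-1 * (f u - f t) @[u --> within `[0, 1] t^'] --> d ->
  (u - t)^-1 * (f u + M * u - (f t + M * t)) @[u --> within `[0, 1] t^'] --> d + M.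
Proof.
move=> df; apply: eq_cvg_punctured01 (cvgD df (cvg_cst M)) => u ut _.
by field.
Qed.

Lemma mxtrace_mul_tr (R : comPzRingType) (n : nat) (M : 'M[R]_n) :
  \tr (M *m M^T) = \sum_i \sum_j M i j ^+ 2.
Proof.
rewrite mxtrace_mul_sum; apply: eq_bigr => i _; apply: eq_bigr => j _.
by rewrite mxE expr2.
Qed.

(** If [G] whitens [P], the cost is the squared Frobenius norm of the control in whitened
    coordinates; nonnegativity and definiteness follow. *)
Lemma cost_term_sqr (R : realType) (n : nat) (P E : 'M[R]_n) : spdmx P ->
  exists G : 'M[R]_n, G \in unitmx /\
    \tr (invmx P *m E *m P *m E^T) = \sum_i \sum_j (G *m E *m invmx G) i j ^+ 2.
Proof.
move=> Pspd; have [G Gu GP] := spdmx_whiten Pspd; exists G; split => //.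
have GTu : G^T \in unitmx by rewrite unitmx_tr.
have Pu := spdmx_unit Pspd.
have PE : P = invmx G *m (invmx G)^T.
  apply: (can_inj (mulKmx Gu)); apply: (can_inj (mulmxK GTu)).
  by rewrite GP mulKVmx // trmx_inv mulVmx.
have KGP : G^T *m (G *m P) = 1%:M by apply: mulmx1C; exact: GP.
have invP : invmx P = G^T *m G.
  by apply: (can_inj (mulmxK Pu)); rewrite mulVmx // -mulmxA KGP.
rewrite -mxtrace_mul_tr !trmx_mul invP {1}PE -!mulmxA mxtrace_mulC.
by rewrite -!mulmxA.
Qed.

Lemma cost_term_ge0 (R : realType) (n : nat) (P E : 'M[R]_n) : spdmx P ->
  0 <= \tr (invmx P *m E *m P *m E^T).
Proof.
move=> /cost_term_sqr -/(_ E)[G [_ ->]].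
by apply: sumr_ge0 => i _; apply: sumr_ge0 => j _; exact: sqr_ge0.
Qed.

Lemma cost_term_eq0 (R : realType) (n : nat) (P E : 'M[R]_n) : spdmx P ->
  \tr (invmx P *m E *m P *m E^T) = 0 -> E = 0.
Proof.
move=> /cost_term_sqr -/(_ E)[G [Gu ->]] /eqP.
rewrite psumr_eq0 => [/allP H|i _]; last by apply: sumr_ge0 => j _; exact: sqr_ge0.
have GE0 : G *m E *m invmx G = 0.
  apply/matrixP => i j; rewrite [RHS]mxE; have := H i (mem_index_enum _).
  rewrite psumr_eq0 => [/allP/(_ j (mem_index_enum _))|k _]; last exact: sqr_ge0.
  by rewrite sqrf_eq0 => /eqP.
apply: (can_inj (mulKmx Gu)); rewrite mulmx0.
by rewrite -[LHS](mulmxK (_ : invmx G \in unitmx)) ?unitmx_inv // GE0 mul0mx.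
Qed.

(* Completing the square: among the controls producing a prescribed
   derivative of the covariance, the cheapest one is [- P *m Pi]. *)
Lemma cost_term_split (R : realType) (n : nat) (P Pi A : 'M[R]_n) :
  spdmx P -> Pi^T = Pi ->
  A *m P + P *m A^T = - (2 *: (P *m Pi *m P)) ->
  \tr (invmx P *m A *m P *m A^T) = \tr (Pi *m P *m Pi *m P)
    + \tr (invmx P *m (A + P *m Pi) *m P *m (A + P *m Pi)^T).
Proof.
move=> Pspd Pisym hA; have Pu := spdmx_unit Pspd; have Psym := proj1 Pspd.
have AT : (A + P *m Pi)^T = A^T + Pi *m P by rewrite linearD /= trmx_mul Psym Pisym.
have h : \tr (A *m P *m Pi) + \tr (Pi *m P *m A^T) = - 2 * \tr (Pi *m P *m Pi *m P).
  have := congr1 (fun M => \tr (Pi *m M)) hA.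
  rewrite mulmxDr mxtraceD mulmxN -scalemxAr -scaleNr mxtraceZ !mulmxA.
  by rewrite [\tr (Pi *m A *m P)]mxtrace_mulC mulmxA [\tr (P *m Pi *m A)]mxtrace_mulC mulmxA.
rewrite AT !(mulmxDr, mulmxDl) !mxtraceD.
have -> : \tr (invmx P *m (P *m Pi) *m P *m A^T) = \tr (Pi *m P *m A^T).
  by rewrite mulKmx.
have -> : \tr (invmx P *m (P *m Pi) *m P *m (Pi *m P)) = \tr (Pi *m P *m Pi *m P).
  by rewrite mulKmx // !mulmxA.
have -> : \tr (invmx P *m A *m P *m (Pi *m P)) = \tr (A *m P *m Pi).
  by rewrite mulmxA mxtrace_mulC !mulmxA mulmxV // mul1mx.
by move: h; lra.
Qed.

Lemma cost_term_optimal (R : realType) (n : nat) (P Pi : 'M[R]_n) :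
  spdmx P -> Pi^T = Pi ->
  \tr (invmx P *m - (P *m Pi) *m P *m (- (P *m Pi))^T) = \tr (Pi *m P *m Pi *m P).
Proof.
move=> Pspd Pisym; rewrite (@cost_term_split _ _ P Pi) //.
  by rewrite addNr mulmx0 !mul0mx mxtrace0 addr0.
have Psym := proj1 Pspd.
by rewrite linearN /= trmx_mul Psym Pisym mulNmx mulmxN mulmxA scaler_nat mulr2n opprD.
Qed.

(** [Pi] is chosen so that the control [- (Q *m Pi)] also produces [q]; [cost_term_split] then
    leaves [\tr (Pi *m Q *m Pi *m Q)] plus a nonnegative term. When [q] is the derivative of [Q],
    the middle trace is an exact derivative, up to sign that of [\tr (invmx Q)]. *)
Lemma cost_term_ge (R : realType) (n : nat) (Q B q : 'M[R]_n) (s : R) :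
  spdmx Q -> q = B *m Q + Q *m B^T + s%:M ->
  4^-1 * (\tr (invmx Q *m q *m (invmx Q *m q))
          - 2 * s * \tr (invmx Q *m q *m invmx Q)
          + s ^+ 2 * \tr (invmx Q *m invmx Q))
  <= \tr (invmx Q *m B *m Q *m B^T).
Proof.
move=> Qspd qE; have Qu := spdmx_unit Qspd; have Qsym := proj1 Qspd.
pose w := q - s%:M.
have wE : w = B *m Q + Q *m B^T by rewrite /w qE addrK.
have wsym : w^T = w by rewrite wE linearD /= !trmx_mul trmxK Qsym addrC.
pose Pi := - 2^-1 *: (invmx Q *m w *m invmx Q).
have Pisym : Pi^T = Pi.
  by rewrite /Pi linearZ /= !trmx_mul trmx_inv Qsym wsym mulmxA.
have hB : B *m Q + Q *m B^T = - (2 *: (Q *m Pi *m Q)).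
  rewrite -wE /Pi -scalemxAr -scalemxAl !mulmxA mulmxV // mul1mx mulmxKV //.
  by rewrite scalerA -scaleNr (_ : - (2 * - 2^-1) = 1) ?scale1r //; field.
rewrite (cost_term_split Qspd Pisym hB) -[leLHS]addr0 lerD ?cost_term_ge0 //.
rewrite le_eqVlt; apply/orP; left; apply/eqP.
have -> : Pi *m Q *m Pi *m Q = 4^-1 *: ((invmx Q *m w) *m (invmx Q *m w)).
  have PiQ : Pi *m Q = - 2^-1 *: (invmx Q *m w) by rewrite /Pi -scalemxAl mulmxKV.
  rewrite -mulmxA PiQ -scalemxAl -scalemxAr scalerA.
  by congr (_ *: _); field.
rewrite mxtraceZ; congr (_ * _).
have -> : invmx Q *m w = invmx Q *m q - s *: invmx Q.
  by rewrite /w mulmxBr mul_mx_scalar.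
have trB (X Y : 'M[R]_n) : \tr (X - Y) = \tr X - \tr Y by exact: linearB.
rewrite mulmxBr !mulmxBl -!scalemxAr -!scalemxAl scalerA !trB !mxtraceZ.
rewrite [\tr (invmx Q *m (invmx Q *m q))]mxtrace_mulC expr2.
by ring.
Qed.

Lemma eq_has_deriv01 (R : realType) (n : nat) (X Y : R -> 'M[R]_n) (t : R) D :
  t \in `[0, 1] -> (forall s, s \in `[0, 1] -> X s = Y s) ->
  has_deriv01_at X t D -> has_deriv01_at Y t D.
Proof.
move=> t01 XY; apply: eq_cvg_punctured01 => s _ s01.
by rewrite !XY.
Qed.

(** The transposed path has derivative [D^T] and agrees with [X] on [[0, 1]]. *)
Lemma has_deriv01_sym (R : realType) (n : nat) (X : R -> 'M[R]_n) (t : R) D :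
  t \in `[0, 1] -> (forall s, s \in `[0, 1] -> (X s)^T = X s) ->
  has_deriv01_at X t D -> D^T = D.
Proof.
move=> t01 Xsym dX; apply: (has_deriv01_unique t01 _ dX).
exact: (eq_has_deriv01 t01 Xsym (has_deriv01T dX)).
Qed.

Lemma trace_bounded01 (R : realType) (n : nat) (X D : R -> 'M[R]_n) :
  has_deriv01 X D ->
  exists2 M : R, 1 <= M & forall t, t \in `[0, 1] -> \tr (X t) <= M.
Proof.
move=> /continuous_trace01 /(EVT_max ler01)[c c01 cmax].
exists (Num.max 1 (\tr (X c))); first by rewrite le_max lexx.
by move=> t t01; rewrite le_max cmax ?orbT.
Qed.

Lemma trace_measurable01 (R : realType) (n : nat) (X D : R -> 'M[R]_n) :
  has_deriv01 X D ->
  measurable_fun (`[0, 1]%classic : set R) (fun t => \tr (X t)).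
Proof.
move=> /continuous_trace01; apply: subspace_continuous_measurable_fun.
exact: measurable_itv.
Qed.

(** * The flow and its comparison with a competitor *)

Section flow.
Variables (R : realType) (n : nat) (s : R) (P Pi : R -> 'M[R]_n).
Hypotheses (P_spd : forall t : R, t \in `[0, 1] -> spdmx (P t))
  (P_ode : has_deriv01 P (fun t => - (2 *: (P t *m Pi t *m P t)) + s%:M))
  (Pi_ode : has_deriv01 Pi (fun t => 2 *: (Pi t *m P t *m Pi t))).

Let dP (t : R) : 'M[R]_n := - (2 *: (P t *m Pi t *m P t)) + s%:M.
(** Equal to [invmx (P t) *m dP t] by [velocityE], in a form that can be differentiated through the
    two equations. *)
Let velocity (t : R) : 'M[R]_n := - (2 *: (Pi t *m P t)) + s *: invmx (P t).

Let P_unit t : t \in `[0, 1] -> P t \in unitmx.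
Proof. by move=> /P_spd/spdmx_unit. Qed.

Let dP_sym t : t \in `[0, 1] -> (dP t)^T = dP t.
Proof.
move=> t01; apply: has_deriv01_sym (P_ode t01) => // u u01.
by case: (P_spd u01).
Qed.

(** As the derivative of a symmetric path, [dP t] is symmetric, hence so is [P t *m Pi t *m P t];
    the invertible [P t] cancels on both sides. *)
Lemma costate_sym t : t \in `[0, 1] -> (Pi t)^T = Pi t.
Proof.
move=> t01; have Pu := P_unit t01; have [Psym _] := P_spd t01.
have := dP_sym t01; rewrite /dP linearD /= tr_scalar_mx linearN linearZ /=.
have two0 : (2 : R) != 0 by rewrite pnatr_eq0.
move=> /addIr/oppr_inj/(scalerI two0).
rewrite !trmx_mul Psym => h; apply: (can_inj (mulKmx Pu)).
by apply: (can_inj (mulmxK Pu)); rewrite -mulmxA.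
Qed.

Let velocityE t : t \in `[0, 1] -> invmx (P t) *m dP t = velocity t.
Proof.
move=> t01; have Pu := P_unit t01.
rewrite /dP /velocity mulmxDr mulmxN -scalemxAr mul_mx_scalar.
by rewrite !mulmxA mulVmx // mul1mx.
Qed.

(** The Euler-Lagrange equation of the kinetic term plus potential; it supplies the potential term
    in the derivative of the calibration. *)
Lemma velocity_deriv t : t \in `[0, 1] ->
  has_deriv01_at velocity t (- (s ^+ 2 *: (invmx (P t) *m invmx (P t)))).
Proof.
move=> t01; have Pu := P_unit t01.
have dV := has_deriv01V t01 P_unit (P_ode t01).
have dM := has_deriv01M (Pi_ode t01) (P_ode t01).
have -> : - (s ^+ 2 *: (invmx (P t) *m invmx (P t))) =
    - (2 *: (2 *: (Pi t *m P t *m Pi t) *m P t + Pi t *m dP t))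
    + s *: - (invmx (P t) *m dP t *m invmx (P t)).
  rewrite velocityE // /velocity /dP mulmxDl mulNmx -!scalemxAl mulmxK //.
  rewrite mulmxDr mulmxN -!scalemxAr mul_mx_scalar !mulmxA.
  move: (Pi t *m P t *m Pi t *m P t) (Pi t) (invmx (P t) *m invmx (P t)) => X Y Z.
  by apply/matrixP => i j; rewrite !mxE; ring.
exact: (has_deriv01D (has_deriv01N (has_deriv01Z dM)) (has_deriv01Z dV)).
Qed.

(** Only differentiability matters: it makes the optimal running cost continuous, hence measurable
    and bounded on [[0, 1]]. *)
Lemma action_deriv : exists D, has_deriv01 (fun t => Pi t *m P t *m Pi t *m P t) D.
Proof.
exists (fun t => (((2 *: (Pi t *m P t *m Pi t)) *m P t + Pi t *m dP t) *m Pi t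
    + Pi t *m P t *m (2 *: (Pi t *m P t *m Pi t))) *m P t
    + Pi t *m P t *m Pi t *m dP t) => t t01.
exact: (has_deriv01M (has_deriv01M (has_deriv01M (Pi_ode t01) (P_ode t01))
  (Pi_ode t01)) (P_ode t01)).
Qed.

Lemma flow_second_order :
  exists ddP : R -> 'M[R]_n, [/\ has_deriv01 dP ddP
    & forall t : R, t \in `[0, 1] ->
        ddP t - dP t *m invmx (P t) *m dP t + (s ^+ 2) *: invmx (P t) = 0].
Proof.
pose dPi t := 2 *: (Pi t *m P t *m Pi t).
(* The final [0] is the derivative of the constant [s%:M]. *)
exists (fun t => - (2 *: ((dP t *m Pi t + P t *m dPi t) *m P t
                          + P t *m Pi t *m dP t)) + 0); split.
  move=> t t01; apply: has_deriv01D (has_deriv01_cst _ _); apply: has_deriv01N.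
  apply: has_deriv01Z; apply: has_deriv01M (P_ode t01).
  exact: has_deriv01M (P_ode t01) (Pi_ode t01).
move=> t t01; have Pu := P_unit t01.
rewrite -[dP t *m _ *m _]mulmxA velocityE // /velocity /dP /dPi addr0.
rewrite !(mulmxDl, mulmxDr, mulmxN, mulNmx, mul_scalar_mx, mul_mx_scalar) -?scalemxAl -?scalemxAr.
rewrite -?scalemxAl -?scalemxAr !mulmxA.
rewrite mulmxK //.
move: (P t *m Pi t *m P t *m Pi t *m P t) (Pi t *m P t) (P t *m Pi t) (invmx (P t)) => X Y Z V.
by apply/matrixP => i j; rewrite !mxE; ring.
Qed.

Variables (Q B : R -> 'M[R]_n).
Hypotheses (Q_spd : forall t : R, t \in `[0, 1] -> spdmx (Q t))
  (Q_ode : has_deriv01 Q (fun t => B t *m Q t + Q t *m (B t)^T + s%:M))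
  (PQ0 : P 0 = Q 0) (PQ1 : P 1 = Q 1).

Let dQ (t : R) : 'M[R]_n := B t *m Q t + Q t *m (B t)^T + s%:M.

(* With the matrix logarithm in place of [mxlogpoly], the trace of the last term is
   half the inner product, in the affine-invariant metric, of [dP t] with the
   initial velocity of the geodesic from [P t] to [Q t]. *)
Definition calibration (c : R) (N : nat) (t : R) : 'M[R]_n :=
  (2^-1 * s) *: (invmx (Q t) - invmx (P t))
  + 2^-1 *: (velocity t *m mxlogpoly c N (invmx (P t) *m Q t)).

Let Q_unit t : t \in `[0, 1] -> Q t \in unitmx.
Proof. by move=> /Q_spd/spdmx_unit. Qed.

Let dQ_sym t : t \in `[0, 1] -> (dQ t)^T = dQ t.
Proof.
move=> t01; apply: has_deriv01_sym (Q_ode t01) => // u u01.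
by case: (Q_spd u01).
Qed.

Lemma calibration_end (c : R) (N : nat) (t : R) :
  t \in `[0, 1] -> P t = Q t -> calibration c N t = 0.
Proof.
move=> t01 PQ; rewrite /calibration -PQ subrr scaler0 add0r mulVmx ?P_unit //.
by rewrite mxlogpoly1 mulmx0 scaler0.
Qed.

Let ratio_deriv t : t \in `[0, 1] ->
  has_deriv01_at (fun u => invmx (P u) *m Q u) t
    (invmx (P t) *m dQ t - velocity t *m (invmx (P t) *m Q t)).
Proof.
move=> t01; rewrite -velocityE // addrC mulmxA -mulNmx.
exact: (has_deriv01M (has_deriv01V t01 P_unit (P_ode t01)) (Q_ode t01)).
Qed.

Let inv_ratio_deriv t : t \in `[0, 1] ->
  has_deriv01_at (fun u => invmx (Q u) *m P u) t
    (- (invmx (Q t) *m dQ t *m invmx (Q t)) *m P t + invmx (Q t) *m dP t).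
Proof.
move=> t01.
exact: (has_deriv01M (has_deriv01V t01 Q_unit (Q_ode t01)) (P_ode t01)).
Qed.

Let dcalibration (c : R) (N : nat) (t : R) : 'M[R]_n :=
  (2^-1 * s) *: (- (invmx (Q t) *m dQ t *m invmx (Q t))
                 - - (invmx (P t) *m dP t *m invmx (P t)))
  + 2^-1 *: (- (s ^+ 2 *: (invmx (P t) *m invmx (P t)))
               *m mxlogpoly c N (invmx (P t) *m Q t)
             + velocity t *m mxlogpoly_deriv c N (invmx (P t) *m Q t)
                 (invmx (P t) *m dQ t - velocity t *m (invmx (P t) *m Q t))).

Let calibration_deriv (c : R) (N : nat) : has_deriv01 (calibration c N) (dcalibration c N).
Proof.
move=> t t01; apply: has_deriv01D; apply: has_deriv01Z.
  exact: (has_deriv01B (has_deriv01V t01 Q_unit (Q_ode t01))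
                       (has_deriv01V t01 P_unit (P_ode t01))).
exact: (has_deriv01M (velocity_deriv t01)
                     (has_deriv01_mxlogpoly (ratio_deriv t01))).
Qed.

(** Its trace is half the coefficient of [r ^+ N] in [trace_action_ge], and it does not depend on
    [N]. *)
Let defect (c : R) (t : R) : 'M[R]_n :=
  4^-1 *: (velocity t *m velocity t)
  + (2^-1 * c * s ^+ 2) *: (invmx (P t) *m invmx (P t)).

(** Half of [trace_action_ge] is added to [cost_term_ge]. The first term of the calibration absorbs
    the traces linear in the velocities, and the remaining terms in [P] alone form the optimal
    cost. *)
Let calibration_growth (c d : R) (N : nat) (t : R) : t \in `[0, 1] ->
  1 <= c -> 1 <= d -> \tr (invmx (P t) *m Q t) <= c -> \tr (invmx (Q t) *m P t) <= d ->
  \tr (dcalibration c N t) <= running_cost Q B t - \tr (Pi t *m P t *m Pi t *m P t)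
    + (1 - (c * d)^-1) ^+ N * \tr (defect c t).
Proof.
move=> t01 c1 d1 trc trd; have [Pspd Qspd] := (P_spd t01, Q_spd t01).
have Pisym := costate_sym t01.
have := cost_term_ge Qspd (erefl (dQ t)).
have := trace_action_ge s N Pspd Qspd (dP_sym t01) (dQ_sym t01) c1 d1 trc trd.
rewrite !velocityE // -/(running_cost Q B t).
have trB (X Y : 'M[R]_n) : \tr (X - Y) = \tr X - \tr Y by exact: linearB.
have trN (X : 'M[R]_n) : \tr (- X) = - \tr X by exact: linearN.
have -> : \tr (Pi t *m P t *m Pi t *m P t) = 4^-1 * (\tr (velocity t *m velocity t)
    - 2 * s * \tr (velocity t *m invmx (P t)) + s ^+ 2 * \tr (invmx (P t) *m invmx (P t))).
  (* [Pi t *m P t] is [- 2^-1] times [velocity t - s *: invmx (P t)]. *)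
  have -> : Pi t *m P t *m Pi t *m P t = 4^-1 *: ((velocity t - s *: invmx (P t)) *m
      (velocity t - s *: invmx (P t))).
    rewrite /velocity addrK mulmxN mulNmx opprK -scalemxAr -scalemxAl !scalerA mulmxA.
    by rewrite (_ : 4^-1 * (2 * 2) = 1) ?scale1r //; field.
  rewrite mulmxBr !mulmxBl -!scalemxAr -!scalemxAl scalerA mxtraceZ !trB !mxtraceZ.
  by rewrite [\tr (invmx (P t) *m velocity t)]mxtrace_mulC; ring.
rewrite /defect /dcalibration !mulNmx -!scalemxAl.
rewrite !(mxtraceD, mxtraceZ, trB, trN) velocityE //.
set x1 := \tr (velocity t *m mxlogpoly_deriv _ _ _ _).
set x2 := \tr (_ *m mxlogpoly _ _ _).
set x3 := \tr (invmx (Q t) *m dQ t *m _); set x4 := \tr (invmx (Q t) *m invmx (Q t)).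
set x5 := \tr (velocity t *m velocity t); set x6 := \tr (velocity t *m invmx (P t)).
set x7 := \tr (invmx (P t) *m invmx (P t)); set x8 := \tr (invmx (Q t) *m dQ t *m invmx _).
set x9 := running_cost _ _ _; set r := (1 - _) ^+ N.
move=> h1 h2; nra.
Qed.

Let optimal_cost (t : R) : R := \tr (Pi t *m P t *m Pi t *m P t).

(** The calibration vanishes at both ends, so its growth bound yields the inequality up to
    [r ^+ N * K]; here [r < 1], and [r] and [K] do not depend on [N]. *)
Lemma optimal_cost_le (mQ : measurable_fun (`[0, 1]%classic : set R) (running_cost Q B)) :
  (\int[lebesgue_measure]_(t in `[0%R, 1%R]) (optimal_cost t)%:E <= cost Q B)%E.
Proof.
have [Dopt opt_deriv] := action_deriv.
(* Traces of differentiable paths are bounded on [[0, 1]], so [c] and [d] serve for all [t], as does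
   [K] below. *)
have [c c1 cP] := trace_bounded01 ratio_deriv.
have [d d1 dP'] := trace_bounded01 inv_ratio_deriv.
have [M M1 MP] := trace_bounded01 opt_deriv.
have defect_deriv : has_deriv01 (defect c) (fun t =>
    4^-1 *: (- (s ^+ 2 *: (invmx (P t) *m invmx (P t))) *m velocity t
             + velocity t *m - (s ^+ 2 *: (invmx (P t) *m invmx (P t))))
    + (2^-1 * c * s ^+ 2) *: (- (invmx (P t) *m dP t *m invmx (P t)) *m invmx (P t)
             + invmx (P t) *m - (invmx (P t) *m dP t *m invmx (P t)))).
  move=> t t01; have dV := has_deriv01V t01 P_unit (P_ode t01).
  have dZ := velocity_deriv t01.
  by apply: has_deriv01D; apply: has_deriv01Z; exact: has_deriv01M.
have [K K1 KP] := trace_bounded01 defect_deriv.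
have K0 : 0 < K by exact: lt_le_trans K1.
set r := 1 - (c * d)^-1.
have cd1 : 1 <= c * d by rewrite mulr_ege1.
have cd0 : 0 < c * d by exact: lt_le_trans cd1.
have r0 : 0 <= r by rewrite subr_ge0 invf_le1.
have r1 : r < 1 by rewrite gtrBl invr_gt0.
have mopt := trace_measurable01 opt_deriv.
have Q_ge0 t : t \in `[0, 1] -> 0 <= running_cost Q B t.
  by move=> t01; apply: cost_term_ge0; exact: Q_spd.
have opt_ge0 t : t \in `[0, 1] -> 0 <= optimal_cost t.
  move=> t01; have Pisym := costate_sym t01.
  by rewrite /optimal_cost -(cost_term_optimal (P_spd t01) Pisym) cost_term_ge0 //; exact: P_spd.
have step N : (\int[lebesgue_measure]_(t in `[0%R, 1%R]) (optimal_cost t)%:E <=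
    cost Q B + (r ^+ N * K)%:E)%E.
  have rK0 : 0 <= r ^+ N * K by rewrite mulr_ge0 ?exprn_ge0 // ltW.
  (* [M] bounds the optimal cost, so [h] is nonnegative as [le_integral_deriv01] requires; the term
     [M * t] of [g] compensates. *)
  pose h t := running_cost Q B t + (M - optimal_cost t) + r ^+ N * K.
  pose g t := \tr (calibration c N t) + M * t.
  have h_ge0 t : t \in `[0, 1] -> 0 <= h t.
    move=> t01; have optM : 0 <= M - optimal_cost t by rewrite subr_ge0; exact: MP.
    by apply: addr_ge0 => //; apply: addr_ge0 => //; exact: Q_ge0.
  have mh : measurable_fun (`[0, 1]%classic : set R) h.
    apply: measurable_funD => //; apply: measurable_funD => //.
    exact: measurable_funB.
  have g01 : g 1 - g 0 = M.
    rewrite /g !calibration_end ?in_itv /= ?lexx ?ler01 // !mxtrace0.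
    by ring.
  have dg t : t \in `[0, 1] ->
      (u - t)^-1 * (g u - g t) @[u --> within `[0, 1] t^'] --> \tr (dcalibration c N t) + M.
    by move=> t01; exact: (cvg_quotient_affine (has_deriv01_trace (@calibration_deriv c N t t01))).
  have dgh t : t \in `[0, 1] -> \tr (dcalibration c N t) + M <= h t.
    move=> t01; have := calibration_growth N t01 c1 d1 (cP t t01) (dP' t t01).
    have := ler_wpM2l (exprn_ge0 N r0) (KP t t01).
    by rewrite /h -/r -/(optimal_cost t); lra.
  have := le_integral_deriv01 dg dgh h_ge0 mh; rewrite g01.
  have E01 t : `[0, 1]%classic t -> t \in `[0, 1] by [].
  (* [cost Q B] may be infinite, so nothing is subtracted: the optimal cost is added to both sides
     of [hM], and only the finite [M] is cancelled. *)
  move=> hM; have : (M%:E + \int[lebesgue_measure]_(t in `[0%R, 1%R]) (optimal_cost t)%:E <=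
      M%:E + (cost Q B + (r ^+ N * K)%:E))%E; last by rewrite leeD2lE.
  apply: (le_trans (leeD2r _ hM)).
  rewrite -ge0_integralD //=; first last.
  - exact/measurable_EFinP.
  - exact/measurable_EFinP.
  rewrite addeCA -EFinD /cost.
  rewrite -[X in (_ <= _ + X)%E]integral_cst01 -ge0_integralD //=; first last.
  - by move=> t _; rewrite lee_fin addr_ge0 // (le_trans ler01).
  - exact/measurable_EFinP.
  rewrite le_eqVlt; apply/orP; left; apply/eqP; apply: eq_integral => t _.
  by rewrite -!EFinD /h; congr (_%:E); ring.
apply/lee_addgt0Pr => e e0.
have [N rN] : exists N, r ^+ N * K <= e.
  have rn : `|r| < 1 by rewrite ger0_norm.
  have /cvgrPdist_le/(_ (e / K) (divr_gt0 e0 K0))[N _ /(_ N (leqnn N))] := cvg_expr rn.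
  rewrite sub0r normrN ger0_norm ?exprn_ge0 // => rN.
  by exists N; rewrite -ler_pdivlMr.
by apply: le_trans (step N) _; rewrite leeD2l // lee_fin.
Qed.

End flow.

Theorem proposition2 (R : realType) (n : nat) (sigma : R) (P0 P1 : 'M[R]_n)
    (P Pi : R -> 'M[R]_n)
    (P0_spd : spdmx P0) (P1_spd : spdmx P1)
    (P_spd : forall t : R, t \in `[0, 1] -> spdmx (P t))
    (P_ode : has_deriv01 P
       (fun t => - (2 *: (P t *m Pi t *m P t)) + (sigma ^+ 2)%:M))
    (Pi_ode : has_deriv01 Pi (fun t => 2 *: (Pi t *m P t *m Pi t)))
    (P_at0 : P 0 = P0) (P_at1 : P 1 = P1) :
  [/\ optimal sigma P0 P1 P (fun t => - (P t *m Pi t)),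
      forall A : R -> 'M[R]_n, optimal sigma P0 P1 P A ->
        {ae lebesgue_measure, forall t : R, t \in `[0, 1] ->
           A t = - (P t *m Pi t)}
    & exists dP ddP : R -> 'M[R]_n,
        [/\ has_deriv01 P dP, has_deriv01 dP ddP
          & forall t : R, t \in `[0, 1] ->
              ddP t - dP t *m invmx (P t) *m dP t
                + (sigma ^+ 4) *: invmx (P t) = 0]].
Proof.
pose s := sigma ^+ 2.
have P_ode' : has_deriv01 P (fun t => - (2 *: (P t *m Pi t *m P t)) + s%:M) by [].
pose opt t := \tr (Pi t *m P t *m Pi t *m P t).
have Pisym t : t \in `[0, 1] -> (Pi t)^T = Pi t by exact: costate_sym P_spd P_ode' t.
have costE t : t \in `[0, 1] -> running_cost P (fun t => - (P t *m Pi t)) t = opt t.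
  by move=> t01; apply: cost_term_optimal; [exact: P_spd|exact: Pisym].
have [Dopt opt_deriv] := action_deriv P_ode' Pi_ode.
have mopt : measurable_fun (`[0, 1]%classic : set R) opt.
  exact: trace_measurable01 opt_deriv.
have control t : t \in `[0, 1] ->
    - (P t *m Pi t) *m P t + P t *m (- (P t *m Pi t))^T = - (2 *: (P t *m Pi t *m P t)).
  move=> t01; have [Psym _] := P_spd t t01.
  rewrite linearN /= trmx_mul Psym Pisym // mulNmx mulmxN mulmxA.
  by rewrite scaler_nat mulr2n opprD.
have adm : admissible sigma P0 P1 P (fun t => - (P t *m Pi t)).
  split; [exact: P_spd| |exact: P_at0|exact: P_at1|].
    by move=> t t01; rewrite control //; exact: P_ode.
  by apply: eq_measurable_fun mopt => t; rewrite inE => /costE ->.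
have cost_opt : cost P (fun t => - (P t *m Pi t)) =
    (\int[lebesgue_measure]_(t in `[0%R, 1%R]) (opt t)%:E)%E.
  by apply: eq_integral => t; rewrite inE => /costE ->.
split.
- split=> // Q B [Q_spd Q_ode Q0 Q1 mQ]; rewrite cost_opt.
  by apply: (optimal_cost_le P_spd P_ode' Pi_ode Q_spd Q_ode) => //; rewrite ?Q0 ?Q1.
(* Uniqueness: the cost of [A] is the optimal cost plus the integral of [gap], which is nonnegative
   and vanishes only where [A t = - (P t *m Pi t)]. *)
- move=> A [[_ A_ode _ _ mA] /(_ _ _ adm)]; rewrite cost_opt => A_le.
  pose gap t := \tr (invmx (P t) *m (A t + P t *m Pi t) *m P t *m (A t + P t *m Pi t)^T).
  have gap_ge0 t : t \in `[0, 1] -> 0 <= gap t.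
    by move=> t01; apply: cost_term_ge0; exact: P_spd.
  have split_cost t : t \in `[0, 1] -> running_cost P A t = opt t + gap t.
    move=> t01; apply: cost_term_split; [exact: P_spd|exact: Pisym|].
    (* Both controls produce the derivative of the same path, which is unique. *)
    exact: (addIr _ (has_deriv01_unique t01 (A_ode t t01) (P_ode t t01))).
  have mgap : measurable_fun (`[0, 1]%classic : set R) gap.
    apply: eq_measurable_fun (measurable_funB mA mopt) => t; rewrite inE => t01.
    by rewrite /= split_cost // addrAC subrr add0r.
  have opt_ge0 t : t \in `[0, 1] -> 0 <= opt t.
    move=> t01; rewrite /opt -(cost_term_optimal (P_spd t t01) (Pisym t t01)).
    by apply: cost_term_ge0; exact: P_spd.
  have gap0 : (\int[lebesgue_measure]_(t in `[0%R, 1%R]) (gap t)%:E = 0)%E.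
    have costA : cost P A = (\int[lebesgue_measure]_(t in `[0%R, 1%R]) (opt t)%:E
        + \int[lebesgue_measure]_(t in `[0%R, 1%R]) (gap t)%:E)%E.
      rewrite -ge0_integralD //=; first last.
      + exact/measurable_EFinP.
      + exact/measurable_EFinP.
      by apply: eq_integral => t; rewrite inE => t01; rewrite -EFinD split_cost.
    have [M M1 optM] := trace_bounded01 opt_deriv.
    (* Finiteness of the optimal cost allows it to be cancelled. *)
    have opt_fin : (\int[lebesgue_measure]_(t in `[0%R, 1%R]) (opt t)%:E \is a fin_num)%E.
      rewrite ge0_fin_numE; last by apply: integral_ge0 => t t01; rewrite lee_fin opt_ge0.
      apply: (@le_lt_trans _ _ M%:E); last exact: ltry.
      rewrite -[leRHS]integral_cst01.
      by apply: ge0_le_integral => //=; exact/measurable_EFinP.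
    apply/eqP; rewrite eq_le integral_ge0 ?andbT => [|t t01]; last by rewrite lee_fin gap_ge0.
    by move: A_le; rewrite costA -[leRHS]adde0 leeD2lE.
  have := (ae_eq_integral_abs lebesgue_measure (measurable_itv `[0, 1])
     ((measurable_EFinP _ _).2 mgap)).1.
  have -> : (\int[lebesgue_measure]_(t in `[0%R, 1%R]) `|(gap t)%:E| = 0)%E.
    rewrite -[RHS]gap0; apply: eq_integral => t; rewrite inE => t01.
    by rewrite gee0_abs // lee_fin gap_ge0.
  move=> /(_ erefl); apply: filterS => t gap_t t01.
  have gapt0 : gap t = 0 := EFin_inj (gap_t t01).
  by move: gapt0 => /(cost_term_eq0 (P_spd t t01))/eqP; rewrite addr_eq0 => /eqP.
have [ddP [ddP_deriv ddP_eq]] := flow_second_order P_spd P_ode' Pi_ode.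
exists (fun t => - (2 *: (P t *m Pi t *m P t)) + s%:M), ddP; split => //.
move=> t t01; have -> : sigma ^+ 4 = s ^+ 2 by rewrite /s -exprM.
exact: ddP_eq.
Qed.
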